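(* Let $\Bbbk$ be a field and let $(A,m,u,\Delta,\varepsilon,\Phi,S)$ be a quasi-bialgebra with preantipode over $\Bbbk$. Let $(A^\circ,\Delta_\circ,\varepsilon_\circ)$ be the finite dual coalgebra of the algebra $A$. Then the coalgebra $A^\circ$ can be endowed with a structure of coquasi-bialgebra with preantipode.
   Context: $\otimes=\otimes_\Bbbk$. Sweedler notation $\Delta(a)=\sum a_1\otimes a_2$. Quasi-bialgebra: an associative unital algebra $A$ with algebra maps $\Delta:A\to A\otimes A$, $\varepsilon:A\to\Bbbk$ satisfying $(\varepsilon\otimes A)\Delta=\mathrm{id}=(A\otimes\varepsilon)\Delta$, and an invertible $\Phi=\sum\Phi^1\otimes\Phi^2\otimes\Phi^3\in A\otimes A\otimes A$ with $\Phi\cdot(\Delta\otimes A)\Delta(a)=(A\otimes\Delta)\Delta(a)\cdot\Phi$ for all $a\in A$, $(1\otimes\Phi)(A\otimes\Delta\otimes A)(\Phi)(\Phi\otimes1)=(A\otimes A\otimes\Delta)(\Phi)(\Delta\otimes A\otimes A)(\Phi)$, and $(A\otimes\varepsilon\otimes A)(\Phi)=1\otimes1$. Preantipode for a quasi-bialgebra: a linear map $S:A\to A$ with $\sum a_1S(ba_2)=\varepsilon(a)S(b)=\sum S(a_1b)a_2$ for all $a,b\in A$ and $\sum\Phi^1S(\Phi^2)\Phi^3=1$. Finite dual coalgebra: $A^\circ=\{f\in A^*\mid \ker f$ contains a two-sided ideal of finite codimension$\}$, with $\Delta_\circ(f)=\sum f_1\otimes f_2$ determined by $f(ab)=\sum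 f_1(a)f_2(b)$ and $\varepsilon_\circ(f)=f(1_A)$. Coquasi-bialgebra: a coassociative counital $\Bbbk$-coalgebra $(H,\Delta,\varepsilon)$ with coalgebra maps $H\otimes H\to H$ (written $ab$), $u:\Bbbk\to H$ ($1_H=u(1)$) and a convolution invertible linear map $\omega:H\otimes H\otimes H\to\Bbbk$ such that, for all $a,b,c,d\in H$: $\sum\omega(a_1\otimes b_1\otimes c_1d_1)\,\omega(a_2b_2\otimes c_2\otimes d_2)=\sum\omega(b_1\otimes c_1\otimes d_1)\,\omega(a_1\otimes b_2c_2\otimes d_2)\,\omega(a_2\otimes b_3\otimes c_3)$; $\omega(a\otimes 1_H\otimes b)=\varepsilon(a)\varepsilon(b)$; $1_Ha=a=a1_H$; $\sum a_1(b_1c_1)\,\omega(a_2\otimes b_2\otimes c_2)=\sum\omega(a_1\otimes b_1\otimes c_1)\,(a_2b_2)c_2$. Preantipode for a coquasi-bialgebra $H$: a $\Bbbk$-linear map $T:H\to H$ with, for all $h\in H$, $\sum T(h_1)_1h_2\otimes T(h_1)_2=1_H\otimes T(h)$; $\sum T(h_2)_1\otimes h_1T(h_2)_2=T(h)\otimes 1_H$; $\sum\omega(h_1\otimes T(h_2)\otimes h_3)=\varepsilon(h)$. *)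

(* Defs.v *)
From HB Require Import structures.
From mathcomp Require Import all_boot all_algebra.
From mathcomp Require Import generic_quotient.
From mathcomp Require Import boolp classical_sets functions.

Set Implicit Arguments.
Unset Strict Implicit.
Unset Printing Implicit Defensive.

Import GRing.Theory.
Local Open Scope quotient_scope.
Local Open Scope ring_scope.

Section TensorDef.
Variables (k : fieldType) (U V : lmodType k).

(* A formal sum of pure tensors is a list of pairs.  No coefficients are
   needed, because c (u ⊗ v) = (c u) ⊗ v; [tens_eq] is the congruence generated
   by the bilinearity relations. *)
Inductive tens_eq : seq (U * V) -> seq (U * V) -> Prop :=
| tens_eq_refl s : tens_eq s s
| tens_eq_sym s t : tens_eq s t -> tens_eq t s
| tens_eq_trans t s r : tens_eq s t -> tens_eq t r -> tens_eq s r
| tens_eq_cat s s' t t' :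
    tens_eq s s' -> tens_eq t t' -> tens_eq (s ++ t) (s' ++ t')
| tens_eq_comm s t : tens_eq (s ++ t) (t ++ s)
| tens_eq_0 v : tens_eq [:: (0, v)] [::]
| tens_eq_addl u u' v : tens_eq [:: (u + u', v)] [:: (u, v); (u', v)]
| tens_eq_addr u v v' : tens_eq [:: (u, v + v')] [:: (u, v); (u, v')]
| tens_eq_scale c u v : tens_eq [:: (c *: u, v)] [:: (u, c *: v)].

Definition tens_eqb : rel (seq (U * V)) := fun s t => `[< tens_eq s t >].

Fact tens_eqb_refl : reflexive tens_eqb.
Proof. by move=> s; apply/asboolP; apply: tens_eq_refl. Qed.

Fact tens_eqb_sym : symmetric tens_eqb.
Proof.
by move=> s t; apply/idP/idP => /asboolP h; apply/asboolP; apply: tens_eq_sym.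
Qed.

Fact tens_eqb_trans : transitive tens_eqb.
Proof.
move=> t s r /asboolP h1 /asboolP h2; apply/asboolP.
exact: tens_eq_trans h1 h2.
Qed.

Canonical tens_equiv := EquivRel tens_eqb tens_eqb_refl tens_eqb_sym tens_eqb_trans.

Definition tensor : Type := {eq_quot tens_equiv}.

HB.instance Definition _ := Choice.on tensor.

Definition to_tensor (s : seq (U * V)) : tensor := \pi_({eq_quot tens_equiv}) s.
Definition of_tensor (t : tensor) : seq (U * V) :=
  @repr _ {eq_quot tens_equiv} t.

Lemma of_tensorK : cancel of_tensor to_tensor.
Proof. by move=> t; rewrite /to_tensor /of_tensor reprK. Qed.

Lemma to_tensorP s t : to_tensor s = to_tensor t <-> tens_eq s t.
Proof.
split; first by move/eqmodP/asboolP.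
by move=> h; apply/eqmodP/asboolP.
Qed.

Lemma of_to_tensor s : tens_eq (of_tensor (to_tensor s)) s.
Proof. by apply/to_tensorP; rewrite of_tensorK. Qed.

Definition tens (u : U) (v : V) : tensor := to_tensor [:: (u, v)].

Definition tensor_add (x y : tensor) := to_tensor (of_tensor x ++ of_tensor y).
Definition tensor_scale (c : k) (x : tensor) :=
  to_tensor [seq (c *: p.1, p.2) | p <- of_tensor x].

Lemma tensor_addE s t :
  tensor_add (to_tensor s) (to_tensor t) = to_tensor (s ++ t).
Proof. by apply/to_tensorP; apply: tens_eq_cat; apply: of_to_tensor. Qed.

Lemma tens_eq_map c s t : tens_eq s t ->
  tens_eq [seq (c *: p.1, p.2) | p <- s] [seq (c *: p.1, p.2) | p <- t].
Proof.
elim=> {s t}.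
- by move=> s; apply: tens_eq_refl.
- by move=> s t _; apply: tens_eq_sym.
- by move=> t s r _ h1 _; apply: tens_eq_trans.
- by move=> s s' t t' _ h1 _ h2; rewrite !map_cat; apply: tens_eq_cat.
- by move=> s t; rewrite !map_cat; apply: tens_eq_comm.
- by move=> v; rewrite /= scaler0; apply: tens_eq_0.
- by move=> u u' v; rewrite /= scalerDr; apply: tens_eq_addl.
- by move=> u v v'; apply: tens_eq_addr.
- move=> d u v /=; rewrite scalerA mulrC -scalerA; apply: tens_eq_scale.
Qed.

Lemma tensor_scaleE c s :
  tensor_scale c (to_tensor s) = to_tensor [seq (c *: p.1, p.2) | p <- s].
Proof. by apply/to_tensorP; apply: tens_eq_map; apply: of_to_tensor. Qed.

Fact tensor_addA : associative tensor_add.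
Proof.
move=> x y z; rewrite -[x]of_tensorK -[y]of_tensorK -[z]of_tensorK.
by rewrite !tensor_addE catA.
Qed.

Fact tensor_addC : commutative tensor_add.
Proof. by move=> x y; apply/to_tensorP; apply: tens_eq_comm. Qed.

Fact tensor_add0 : left_id (to_tensor [::]) tensor_add.
Proof. by move=> x; rewrite -[x]of_tensorK tensor_addE. Qed.

Fact tensor_addN : left_inverse (to_tensor [::]) (tensor_scale (-1)) tensor_add.
Proof.
move=> x; rewrite -[x]of_tensorK; move: (of_tensor x) => s {x}.
rewrite tensor_scaleE tensor_addE; apply/to_tensorP.
elim: s => [|[u v] s IHs] /=; first exact: tens_eq_refl.
set s' := map _ s in IHs *.
have h : tens_eq ((-1 *: u, v) :: s' ++ (u, v) :: s)
                 ([:: (-1 *: u, v); (u, v)] ++ (s' ++ s)).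
  rewrite -cat1s -[in X in tens_eq _ X]cat1s -(cat1s _ s) -catA.
  apply: tens_eq_cat; first exact: tens_eq_refl.
  rewrite !catA; apply: tens_eq_cat; last exact: tens_eq_refl.
  exact: tens_eq_comm.
apply: tens_eq_trans h _; rewrite -[X in tens_eq _ X]cats0.
apply: tens_eq_cat IHs.
apply: tens_eq_trans (tens_eq_sym (tens_eq_addl _ _ _)) _.
by rewrite scaleN1r addNr; apply: tens_eq_0.
Qed.

HB.instance Definition _ := GRing.isZmodule.Build tensor
  tensor_addA tensor_addC tensor_add0 tensor_addN.

Lemma to_tensor_cat s t : to_tensor (s ++ t) = to_tensor s + to_tensor t.
Proof. by rewrite -tensor_addE. Qed.

Lemma to_tensorE s : to_tensor s = \sum_(p <- s) tens p.1 p.2.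
Proof.
elim: s => [|[u v] s IHs]; first by rewrite big_nil.
by rewrite big_cons -cat1s to_tensor_cat IHs.
Qed.

Lemma tensDl u u' v : tens (u + u') v = tens u v + tens u' v.
Proof. by rewrite -to_tensor_cat; apply/to_tensorP; apply: tens_eq_addl. Qed.

Lemma tensDr u v v' : tens u (v + v') = tens u v + tens u v'.
Proof. by rewrite -to_tensor_cat; apply/to_tensorP; apply: tens_eq_addr. Qed.

Fact tensor_scalerA a b x :
  tensor_scale a (tensor_scale b x) = tensor_scale (a * b) x.
Proof.
rewrite -[x]of_tensorK !tensor_scaleE -map_comp; congr to_tensor.
by apply: eq_map => p /=; rewrite scalerA.
Qed.

Fact tensor_scale1r : left_id 1 tensor_scale.
Proof.
move=> x; rewrite -[x]of_tensorK !tensor_scaleE; congr to_tensor.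
by rewrite -[RHS]map_id; apply: eq_map => -[u v] /=; rewrite scale1r.
Qed.

Fact tensor_scalerDr : right_distributive tensor_scale +%R.
Proof.
move=> c x y; rewrite -[x]of_tensorK -[y]of_tensorK -to_tensor_cat.
by rewrite !tensor_scaleE map_cat to_tensor_cat.
Qed.

Fact tensor_scalerDl x : {morph tensor_scale^~ x : a b / a + b}.
Proof.
move=> a b; rewrite -[x]of_tensorK !tensor_scaleE !to_tensorE !big_map.
by rewrite -big_split; apply: eq_bigr => p _ /=; rewrite scalerDl tensDl.
Qed.

HB.instance Definition _ := GRing.Zmodule_isLmodule.Build k tensor
  tensor_scalerA tensor_scale1r tensor_scalerDr tensor_scalerDl.

Lemma tensZl c u v : tens (c *: u) v = c *: tens u v.
Proof. by rewrite [RHS]tensor_scaleE. Qed.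

Lemma tensZr c u v : tens u (c *: v) = c *: tens u v.
Proof. by rewrite -tensZl; apply/esym/to_tensorP; apply: tens_eq_scale. Qed.

Lemma tens_bilinear : bilinear_for *:%R *:%R tens.
Proof.
by split=> [v|u] c x y; rewrite ?tensDl ?tensDr ?tensZl ?tensZr.
Qed.

HB.instance Definition _ :=
  bilinear_isBilinear.Build k U V tensor *:%R *:%R tens tens_bilinear.

End TensorDef.

Arguments tens {k U V} u v : simpl never.
Arguments to_tensor {k U V} s : simpl never.
Arguments of_tensor {k U V} t : simpl never.

Notation "U \otimes V" := (tensor U V)
  (at level 40, left associativity) : type_scope.
Notation "u ⊗ v" := (tens u v) (at level 40, left associativity) : ring_scope.

(* [\tsum_(x, y <- t) F x y] is \sum_i F x_i y_i for a chosen decomposition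
   t = \sum_i x_i ⊗ y_i.  When [F] is bilinear the choice is irrelevant, and
   [tsum F] is the linear map induced by [F] ([tsum_tens], [tsum_is_linear]);
   it is only used for bilinear [F]. *)
Definition tsum (k : fieldType) (U V : lmodType k) (W : nmodType)
    (F : U -> V -> W) (t : U \otimes V) : W :=
  \sum_(p <- of_tensor t) F p.1 p.2.

(* Iterated tensor products associate to the left, A ⊗ A ⊗ A = (A ⊗ A) ⊗ A,
   and [\tsum_(x, y, z <- t) F x y z] is \sum_i F x_i y_i z_i for
   t = \sum_i (x_i ⊗ y_i) ⊗ z_i. *)
Definition tsum3 (k : fieldType) (U V W : lmodType k) (X : nmodType)
    (F : U -> V -> W -> X) (t : (U \otimes V) \otimes W) : X :=
  tsum (fun xy z => tsum (fun x y => F x y z) xy) t.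

Notation "\tsum_ ( x , y <- t ) F" := (tsum (fun x y => F) t)
  (at level 41, F at level 41, x name, y name, t at level 50,
   format "'[' \tsum_ ( x ,  y  <-  t ) '/  '  F ']'") : ring_scope.
Notation "\tsum_ ( x , y , z <- t ) F" := (tsum3 (fun x y z => F) t)
  (at level 41, F at level 41, x name, y name, z name, t at level 50,
   format "'[' \tsum_ ( x ,  y ,  z  <-  t ) '/  '  F ']'") : ring_scope.

Section TensorTheory.
Variables (k : fieldType) (U V : lmodType k).
Implicit Types (t : U \otimes V).

Lemma tensor_decomp t : t = \sum_(p <- of_tensor t) p.1 ⊗ p.2.
Proof. by rewrite -to_tensorE of_tensorK. Qed.

Lemma tensor_ind (P : U \otimes V -> Prop) : P 0 -> (forall u v, P (u ⊗ v)) ->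
  (forall s t, P s -> P t -> P (s + t)) -> forall t, P t.
Proof.
move=> P0 Pt PD t; rewrite [t]tensor_decomp.
by elim/big_ind: _ => // -[u v] _; apply: Pt.
Qed.

Lemma eq_tsum (W : nmodType) (F G : U -> V -> W) t :
  F =2 G -> tsum F t = tsum G t.
Proof. by move=> eFG; apply: eq_bigr => p _; rewrite eFG. Qed.

Lemma tsum_addf (W : nmodType) (F G : U -> V -> W) t :
  tsum (fun u v => F u v + G u v) t = tsum F t + tsum G t.
Proof. by rewrite /tsum big_split. Qed.

Lemma tsum_scalef (W : lmodType k) c (F : U -> V -> W) t :
  tsum (fun u v => c *: F u v) t = c *: tsum F t.
Proof. by rewrite /tsum scaler_sumr. Qed.

Section Lift.
Variables (W : lmodType k) (F : U -> V -> W).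
Hypothesis F_bilin : bilinear_for *:%R *:%R F.

Let F0 v : F 0 v = 0.
Proof. by have := F_bilin.1 v (-1) 0 0; rewrite /= scaler0 addr0 scaleN1r addNr. Qed.

Let FDl u u' v : F (u + u') v = F u v + F u' v.
Proof. by have := F_bilin.1 v 1 u u'; rewrite /= !scale1r. Qed.

Let FDr u v v' : F u (v + v') = F u v + F u v'.
Proof. by have := F_bilin.2 u 1 v v'; rewrite /= !scale1r. Qed.

Let FZl c u v : F (c *: u) v = c *: F u v.
Proof. by have := F_bilin.1 v c u 0; rewrite /= !addr0 F0 addr0. Qed.

Let FZr c u v : F u (c *: v) = c *: F u v.
Proof.
have F0r : F u 0 = 0.
  by have := F_bilin.2 u (-1) 0 0; rewrite /= scaler0 addr0 scaleN1r addNr.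
by have := F_bilin.2 u c v 0; rewrite /= !addr0 F0r addr0.
Qed.

Lemma tsum_to_tensor s : tsum F (to_tensor s) = \sum_(p <- s) F p.1 p.2.
Proof.
rewrite /tsum; have := of_to_tensor s; move: (of_tensor _) => r.
elim=> {s r} //.
- by move=> t s r _ -> _ ->.
- by move=> s s' t t' _ IHs _ IHt; rewrite !big_cat IHs IHt.
- by move=> s t; rewrite !big_cat /= addrC.
- by move=> v; rewrite big_seq1 big_nil F0.
- by move=> u u' v; rewrite !big_cons !big_nil /= !addr0 FDl.
- by move=> u v v'; rewrite !big_cons !big_nil /= !addr0 FDr.
- by move=> c u v; rewrite !big_seq1 /= FZl FZr.
Qed.

Lemma tsum_tens u v : tsum F (u ⊗ v) = F u v.
Proof. by rewrite tsum_to_tensor big_seq1. Qed.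

Lemma tsum_is_linear : linear (tsum F).
Proof.
move=> c x y; rewrite -[x]of_tensorK -[y]of_tensorK.
rewrite [c *: _]tensor_scaleE -to_tensor_cat !tsum_to_tensor big_cat big_map.
by congr (_ + _); rewrite scaler_sumr; apply: eq_bigr => p _; rewrite FZl.
Qed.

End Lift.

Lemma tensor_linear_ext (W : lmodType k) (f g : U \otimes V -> W) :
  linear f -> linear g -> (forall u v, f (u ⊗ v) = g (u ⊗ v)) -> f =1 g.
Proof.
move=> lf lg efg; have D h (lh : linear h) x y : h (x + y) = h x + h y :> W.
  by have := lh 1 x y; rewrite !scale1r.
have Z h (lh : linear h) : h 0 = 0 :> W.
  by have := lh (-1) 0 0; rewrite scaler0 addr0 scaleN1r addNr.
elim/tensor_ind=> [|//|s t IHs IHt]; first by rewrite !Z.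
by rewrite !D // IHs IHt.
Qed.

Lemma tensor_indep t : exists n (x : 'I_n -> U) (y : 'I_n -> V),
  t = \sum_i x i ⊗ y i /\
  forall c : 'I_n -> k, \sum_i c i *: y i = 0 -> forall i, c i = 0.
Proof.
pose P n := `[< exists (x : 'I_n -> U) (y : 'I_n -> V), t = \sum_i x i ⊗ y i >].
have exP : exists n, P n.
  exists (size (of_tensor t)); apply/asboolP.
  exists (fun i => (tnth (in_tuple (of_tensor t)) i).1).
  exists (fun i => (tnth (in_tuple (of_tensor t)) i).2).
  rewrite {1}[t]tensor_decomp.
  by rewrite (big_tnth _ _ (of_tensor t)).
case: (ex_minnP exP) => n /asboolP [x [y tE]] minn.
exists n, x, y; split=> // c cy0 j; apply/eqP/negPn/negP => cj0.
case: n x y tE minn c cy0 j cj0 => [|n] x y tE minn c cy0 j cj0.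
  by case: j {cj0} => - [].
suff : P n by move/minn; rewrite ltnn.
apply/asboolP; exists (fun i => x (lift j i) - (c (lift j i) / c j) *: x j).
exists (fun i => y (lift j i)).
move: cy0; rewrite (bigD1_ord j) //= => /eqP; rewrite addr_eq0 => /eqP cy0.
have yj : y j = - \sum_(i < n) (c (lift j i) / c j) *: y (lift j i).
  rewrite -[LHS]scale1r -(mulVf cj0) -scalerA cy0 scalerN scaler_sumr.
  by congr (- _); apply: eq_bigr => i _; rewrite scalerA mulrC.
rewrite tE (bigD1_ord j) //= yj linearNr linear_sumr /= -sumrN -big_split.
apply: eq_bigr => i _ /=.
by rewrite linearBl /= addrC linearZl_LR linearZr_LR.
Qed.

End TensorTheory.

HB.instance Definition _ (k : fieldType) (U V W : lmodType k)
    (F : {bilinear U -> V -> W}) :=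
  GRing.isLinear.Build k (U \otimes V)%type W *:%R (tsum F)
    (tsum_is_linear
       (fun v => linearPl F v, fun u => linearPr F u)).


Lemma exists_functional (k : fieldType) (U : lmodType k) (u : U) :
  u != 0 -> exists f : {linear U -> k^o}, f u = 1.
Proof.
move=> u0.
pose P (A : set U) := ~ A u /\ forall c x y, A x -> A y -> A (c *: x + y).
have [F FP Ftot|A [[Au Alin] Amax]] := @Zorn_bigcup U P.
  split=> [[A FA Au]|c x y [A FA Ax] [B FB By]]; first by have [] := FP A FA.
  have [AB|BA] := Ftot A B FA FB.
    by exists B => //; have [_] := FP B FB; apply=> //; apply: AB.
  by exists A => //; have [_] := FP A FA; apply=> //; apply: BA.
have A0 : A 0.
  apply: contrapT => nA0; have nA x : ~ A x.
    by move=> Ax; apply: nA0; rewrite -[0](addNr x) -scaleN1r; apply: Alin.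
  apply: (Amax [set 0]%classic).
    by split=> [x /nA //|h]; apply: nA0; apply: h.
  split=> [/eqP|c x y -> ->]; first by rewrite (negPf u0).
  by rewrite scaler0 addr0.
have AZ c x : A x -> A (c *: x) by move=> Ax; rewrite -[_ *: _]addr0; apply: Alin.
have AD x y : A x -> A y -> A (x + y).
  by move=> Ax; rewrite -[x]scale1r; apply: Alin.
have ex x : exists c : k, A (x - c *: u).
  have [Ax|nAx] := pselect (A x); first by exists 0; rewrite scale0r subr0.
  pose B : set U := fun y => exists c, A (y - c *: x).
  have AB : (A `<` B)%classic.
    split=> [y Ay|h]; first by exists 0; rewrite scale0r subr0.
    by apply: nAx; apply: h; exists 1; rewrite scale1r subrr.
  have Blin c y z : B y -> B z -> B (c *: y + z).
    move=> [d Ad] [e Ae]; exists (c * d + e).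
    rewrite scalerDl opprD addrACA -scalerA -scalerBr; exact: Alin.
  have [c Ac] : B u by apply: contrapT => nBu; apply: (Amax B AB).
  have c0 : c != 0.
    by apply/eqP => c0; apply: Au; rewrite c0 scale0r subr0 in Ac.
  exists c^-1; have -> : x - c^-1 *: u = (- c^-1) *: (u - c *: x).
    by rewrite scalerBr scalerA mulNr mulVf // !scaleNr scale1r opprK addrC.
  exact: AZ.
have uniq x c d : A (x - c *: u) -> A (x - d *: u) -> c = d.
  move=> Ac Ad; apply/eqP; apply: contrapT => /negP; rewrite -subr_eq0 => cd.
  apply: Au; rewrite -[u]scale1r -(mulVf cd) -scalerA; apply: (AZ).
  have -> : (c - d) *: u = (x - d *: u) + (-1) *: (x - c *: u).
    by rewrite scaleN1r opprB scalerBl [RHS]addrC addrA subrK.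
  by apply: AD => //; apply: AZ.
pose f (x : U) : k^o := sval (cid (ex x)).
have fP x : A (x - f x *: u) by rewrite /f; case: cid.
have flin : linear f.
  move=> c x y; apply: (uniq (c *: x + y)) (fP _) _.
  rewrite scalerDl opprD addrACA -scalerA -scalerBr; exact: Alin.
pose fm := GRing.isLinear.Build k U k^o *:%R f flin.
pose fL : {linear U -> k^o} := HB.pack f fm.
exists fL; apply: (uniq u) (fP _) _.
by rewrite scale1r subrr.
Qed.

Lemma tens_neq0 (k : fieldType) (U V : lmodType k) (u : U) (v : V) :
  u != 0 -> v != 0 -> u ⊗ v != 0.
Proof.
move=> /exists_functional[f fu] /exists_functional[g gv].
pose F (x : U) (y : V) : k^o := f x * g y.
have Fb : bilinear_for *:%R *:%R F.
  split=> [y|x] c a b; rewrite /F linearP /= ?mulrDl ?mulrDr.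
    by rewrite -scalerAl.
  by rewrite -scalerAr.
apply/eqP => uv0; have := tsum_tens Fb u v; rewrite uv0.
have : tsum F 0 = 0.
  by have := tsum_is_linear Fb (-1) 0 0; rewrite scaler0 addr0 scaleN1r addNr.
by move=> -> /eqP; rewrite /F fu gv mulr1 eq_sym oner_eq0.
Qed.

Section TensorAlgebra.
Variables (k : fieldType) (A B : algType k).
Implicit Types (s t : A \otimes B) (a c : A) (b d : B).

Definition tensor_mul s t : A \otimes B :=
  \tsum_(a, b <- s) \tsum_(c, d <- t) (a * c) ⊗ (b * d).

Let mul_inner_bilin a b :
  bilinear_for *:%R *:%R (fun c d => (a * c) ⊗ (b * d) : A \otimes B).
Proof.
split=> [d|c] x y z; rewrite mulrDr -scalerAr ?tensDl ?tensDr.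
  by rewrite tensZl.
by rewrite tensZr.
Qed.

Let mul_outer_bilin t :
  bilinear_for *:%R *:%R (fun a b => \tsum_(c, d <- t) (a * c) ⊗ (b * d)).
Proof.
split=> [b|a] x y z /=; rewrite -tsum_scalef -tsum_addf; apply: eq_tsum => c d.
  by rewrite mulrDl -scalerAl tensDl tensZl.
by rewrite mulrDl -scalerAl tensDr tensZr.
Qed.

Lemma tensor_mul_tens a b c d :
  tensor_mul (a ⊗ b) (c ⊗ d) = (a * c) ⊗ (b * d).
Proof.
rewrite /tensor_mul (tsum_tens (mul_outer_bilin _)).
exact: (tsum_tens (mul_inner_bilin _ _)).
Qed.

Fact tensor_mulDl : left_distributive tensor_mul +%R.
Proof.
move=> x y z; have := tsum_is_linear (mul_outer_bilin z) 1 x y.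
by rewrite !scale1r.
Qed.

Fact tensor_mulZl x (e : k) y : tensor_mul (e *: x) y = e *: tensor_mul x y.
Proof.
have := tsum_is_linear (mul_outer_bilin y) e x 0.
have -> : tsum (fun a b => \tsum_(c, d <- y) (a * c) ⊗ (b * d)) 0 = 0.
  have := tsum_is_linear (mul_outer_bilin y) (-1) 0 0.
  by rewrite scaler0 addr0 scaleN1r addNr.
by rewrite !addr0.
Qed.

Lemma tensor_mulE s (p : seq (A * B)) : tensor_mul s (to_tensor p) =
  \tsum_(a, b <- s) \sum_(q <- p) (a * q.1) ⊗ (b * q.2).
Proof.
apply: eq_tsum => a b; exact: (tsum_to_tensor (mul_inner_bilin a b)).
Qed.

Fact tensor_mulDr : right_distributive tensor_mul +%R.
Proof.
move=> x y z; rewrite -[y]of_tensorK -[z]of_tensorK -to_tensor_cat !tensor_mulE.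
by rewrite -tsum_addf; apply: eq_tsum => a b; rewrite big_cat.
Qed.

Fact tensor_mulZr x (e : k) y : tensor_mul x (e *: y) = e *: tensor_mul x y.
Proof.
rewrite -tsum_scalef; apply: eq_tsum => a b.
have := tsum_is_linear (mul_inner_bilin a b) e y 0.
have -> : tsum (fun c d => (a * c) ⊗ (b * d)) 0 = 0 :> A \otimes B.
  have := tsum_is_linear (mul_inner_bilin a b) (-1) 0 0.
  by rewrite scaler0 addr0 scaleN1r addNr.
by rewrite !addr0.
Qed.

Let mul0t t : tensor_mul 0 t = 0.
Proof. by rewrite -[X in tensor_mul X](scale0r 0) tensor_mulZl scale0r. Qed.

Let mult0 t : tensor_mul t 0 = 0.
Proof. by rewrite -[X in tensor_mul _ X](scale0r 0) tensor_mulZr scale0r. Qed.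

Fact tensor_mulA : associative tensor_mul.
Proof.
elim/tensor_ind=> [|a b|x y IHx IHy] t r; first by rewrite !mul0t.
  elim/tensor_ind: t r => [|c d|x y IHx IHy] r; first by rewrite !(mul0t, mult0).
    elim/tensor_ind: r => [|e f|x y IHx IHy]; first by rewrite !mult0.
      by rewrite !tensor_mul_tens !mulrA.
    by rewrite !tensor_mulDr IHx IHy.
  by rewrite !(tensor_mulDl, tensor_mulDr) IHx IHy.
by rewrite !tensor_mulDl IHx IHy.
Qed.

Fact tensor_mul1t : left_id (1 ⊗ 1) tensor_mul.
Proof.
elim/tensor_ind=> [|a b|x y IHx IHy]; first exact: mult0.
  by rewrite tensor_mul_tens !mul1r.
by rewrite tensor_mulDr IHx IHy.
Qed.

Fact tensor_mult1 : right_id (1 ⊗ 1) tensor_mul.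
Proof.
elim/tensor_ind=> [|a b|x y IHx IHy]; first exact: mul0t.
  by rewrite tensor_mul_tens !mulr1.
by rewrite tensor_mulDl IHx IHy.
Qed.

Fact tensor_1neq0 : (1 ⊗ 1 : A \otimes B) != 0.
Proof. by apply: tens_neq0; apply: oner_neq0. Qed.

HB.instance Definition _ := GRing.Zmodule_isNzRing.Build (A \otimes B)%type
  tensor_mulA tensor_mul1t tensor_mult1 tensor_mulDl tensor_mulDr tensor_1neq0.

HB.instance Definition _ := GRing.Lmodule_isLalgebra.Build k (A \otimes B)%type
  (fun e x y => esym (tensor_mulZl x e y)).

HB.instance Definition _ := GRing.Lalgebra_isAlgebra.Build k (A \otimes B)%type
  (fun e x y => esym (tensor_mulZr x e y)).

Lemma tensM a b c d : (a ⊗ b) * (c ⊗ d) = (a * c) ⊗ (b * d) :> A \otimes B.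
Proof. exact: tensor_mul_tens. Qed.

Lemma tens1 : 1 = 1 ⊗ 1 :> A \otimes B.
Proof. by []. Qed.

End TensorAlgebra.

Section Coalgebra.
Variable k : fieldType.
Implicit Types C D : lmodType k.

Definition tmap C D C' D' (f : C -> C') (g : D -> D') (t : C \otimes D)
    : C' \otimes D' :=
  \tsum_(x, y <- t) f x ⊗ g y.

Definition coalgebra C (Delta : {linear C -> C \otimes C}) (eps : {linear C -> k^o})
    : Prop :=
  [/\ forall c, \tsum_(c1, c2 <- Delta c) Delta c1 ⊗ c2 =
        \tsum_(c1, c2 <- Delta c) \tsum_(c21, c22 <- Delta c2) c1 ⊗ c21 ⊗ c22,
      forall c, \tsum_(c1, c2 <- Delta c) eps c1 *: c2 = c
    & forall c, \tsum_(c1, c2 <- Delta c) eps c2 *: c1 = c].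

Definition tcomul C D (DeltaC : C -> C \otimes C) (DeltaD : D -> D \otimes D)
    (t : C \otimes D) : (C \otimes D) \otimes (C \otimes D) :=
  \tsum_(c, d <- t) \tsum_(c1, c2 <- DeltaC c) \tsum_(d1, d2 <- DeltaD d)
    (c1 ⊗ d1) ⊗ (c2 ⊗ d2).

Definition tcounit C D (epsC : C -> k^o) (epsD : D -> k^o) (t : C \otimes D) : k^o :=
  \tsum_(c, d <- t) epsC c * epsD d.

(* The identification k = k ⊗ k. *)
Definition kcomul (c : k^o) : k^o \otimes k^o := c ⊗ (1 : k^o).

Definition kcounit (c : k^o) : k^o := c.

Definition coalgebra_morphism C D (DeltaC : C -> C \otimes C) (epsC : C -> k^o)
    (DeltaD : D -> D \otimes D) (epsD : D -> k^o) (f : C -> D) : Prop :=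
  (forall c, DeltaD (f c) = tmap f f (DeltaC c)) /\
  (forall c, epsD (f c) = epsC c).

Definition convolution C (Delta : C -> C \otimes C) (f g : C -> k^o) (c : C) : k^o :=
  \tsum_(c1, c2 <- Delta c) f c1 * g c2.

Definition convolution_invertible C (Delta : C -> C \otimes C) (eps : C -> k^o)
    (f : {linear C -> k^o}) : Prop :=
  exists g : {linear C -> k^o},
    (forall c, convolution Delta f g c = eps c) /\
    (forall c, convolution Delta g f c = eps c).

End Coalgebra.

Section QuasiBialgebra.
Variables (k : fieldType) (A : algType k).
Variables (Delta : {lrmorphism A -> A \otimes A}) (eps : {lrmorphism A -> k^o}).
Variable Phi : A \otimes A \otimes A.

Record quasi_bialgebra : Prop := QuasiBialgebra {
  qb_counitl : forall a, \tsum_(a1, a2 <- Delta a) eps a1 *: a2 = a;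
  qb_counitr : forall a, \tsum_(a1, a2 <- Delta a) eps a2 *: a1 = a;
  qb_Phi_invertible :
    exists Psi : A \otimes A \otimes A, Phi * Psi = 1 /\ Psi * Phi = 1;
  qb_coassoc : forall a,
    Phi * (\tsum_(a1, a2 <- Delta a) Delta a1 ⊗ a2) =
    (\tsum_(a1, a2 <- Delta a) \tsum_(a21, a22 <- Delta a2) a1 ⊗ a21 ⊗ a22)
      * Phi;
  (* (1 ⊗ Φ) (A ⊗ Δ ⊗ A)(Φ) (Φ ⊗ 1) = (A ⊗ A ⊗ Δ)(Φ) (Δ ⊗ A ⊗ A)(Φ) *)
  qb_cocycle :
    (\tsum_(x, y, z <- Phi) 1 ⊗ x ⊗ y ⊗ z)
    * (\tsum_(x, y, z <- Phi) \tsum_(y1, y2 <- Delta y) x ⊗ y1 ⊗ y2 ⊗ z)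
    * (Phi ⊗ 1)
    = (\tsum_(x, y, z <- Phi) \tsum_(z1, z2 <- Delta z) x ⊗ y ⊗ z1 ⊗ z2)
      * (\tsum_(x, y, z <- Phi) Delta x ⊗ y ⊗ z);
  qb_Phi_normal : \tsum_(x, y, z <- Phi) x ⊗ (eps y *: z) = 1 ⊗ 1
}.

Record qb_preantipode (S : {linear A -> A}) : Prop := QBPreantipode {
  qb_preantipode_l : forall a b : A,
    \tsum_(a1, a2 <- Delta a) a1 * S (b * a2) = eps a *: S b;
  qb_preantipode_r : forall a b : A,
    \tsum_(a1, a2 <- Delta a) S (a1 * b) * a2 = eps a *: S b;
  qb_preantipode_Phi : \tsum_(x, y, z <- Phi) x * S y * z = 1
}.

End QuasiBialgebra.

Section CoquasiBialgebra.
Variables (k : fieldType) (H : lmodType k).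
Variables (Delta : {linear H -> H \otimes H}) (eps : {linear H -> k^o}).
Variables (mul : {linear H \otimes H -> H}) (u : {linear k^o -> H}).
Variable omega : {linear H \otimes H \otimes H -> k^o}.

Local Notation "x ** y" := (mul (x ⊗ y)) (at level 39, left associativity).
Local Notation "1_H" := (u 1).
Local Notation w x y z := (omega (x ⊗ y ⊗ z)).

Definition comul3 (h : H) : H \otimes H \otimes H :=
  \tsum_(h1, h2 <- Delta h) Delta h1 ⊗ h2.

Record coquasi_bialgebra : Prop := CoquasiBialgebra {
  cqb_coalgebra : coalgebra Delta eps;
  cqb_mul_morphism : coalgebra_morphism
    (tcomul Delta Delta) (tcounit eps eps) Delta eps mul;
  cqb_unit_morphism : coalgebra_morphism
    (@kcomul k) (@kcounit k) Delta eps u;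
  cqb_omega_invertible : convolution_invertible
    (tcomul (tcomul Delta Delta) Delta) (tcounit (tcounit eps eps) eps) omega;
  cqb_cocycle : forall a b c d,
    \tsum_(a1, a2 <- Delta a) \tsum_(b1, b2 <- Delta b)
    \tsum_(c1, c2 <- Delta c) \tsum_(d1, d2 <- Delta d)
      w a1 b1 (c1 ** d1) * w (a2 ** b2) c2 d2
    = \tsum_(a1, a2 <- Delta a) \tsum_(b1, b2, b3 <- comul3 b)
      \tsum_(c1, c2, c3 <- comul3 c) \tsum_(d1, d2 <- Delta d)
        w b1 c1 d1 * w a1 (b2 ** c2) d2 * w a2 b3 c3;
  cqb_omega_unit : forall a b, w a 1_H b = eps a * eps b;
  cqb_mul1l : forall a, 1_H ** a = a;
  cqb_mul1r : forall a, a ** 1_H = a;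
  cqb_mulA : forall a b c,
    \tsum_(a1, a2 <- Delta a) \tsum_(b1, b2 <- Delta b)
    \tsum_(c1, c2 <- Delta c) w a2 b2 c2 *: (a1 ** (b1 ** c1))
    = \tsum_(a1, a2 <- Delta a) \tsum_(b1, b2 <- Delta b)
      \tsum_(c1, c2 <- Delta c) w a1 b1 c1 *: ((a2 ** b2) ** c2)
}.

Record cqb_preantipode (T : {linear H -> H}) : Prop := CQBPreantipode {
  cqb_preantipode_l : forall h,
    \tsum_(h1, h2 <- Delta h) \tsum_(t1, t2 <- Delta (T h1)) (t1 ** h2) ⊗ t2
    = 1_H ⊗ T h;
  cqb_preantipode_r : forall h,
    \tsum_(h1, h2 <- Delta h) \tsum_(t1, t2 <- Delta (T h2)) t1 ⊗ (h1 ** t2)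
    = T h ⊗ 1_H;
  cqb_preantipode_omega : forall h,
    \tsum_(h1, h2, h3 <- comul3 h) w h1 (T h2) h3 = eps h
}.

End CoquasiBialgebra.

Section FiniteDual.
Variables (k : fieldType) (A : algType k).

Record two_sided_ideal (I : set A) : Prop := TwoSidedIdeal {
  ideal0 : I 0;
  idealD : forall x y, I x -> I y -> I (x + y);
  idealMl : forall a x, I x -> I (a * x);
  idealMr : forall a x, I x -> I (x * a)
}.

(* A / I ≅ k^n for some n, through a surjection A -> k^n with kernel I. *)
Definition finite_codimension (I : set A) : Prop :=
  exists n (p : {linear A -> 'rV[k]_n}),
    (forall v, exists a, p a = v) /\ (forall a, p a = 0 <-> I a).

Definition in_finite_dual (f : A -> k^o) : Prop :=
  linear f /\ exists I : set A,
    [/\ two_sided_ideal I, finite_codimension I & forall a, I a -> f a = 0].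

Definition finite_dual_pred : {pred A -> k^o} := fun f => `[< in_finite_dual f >].

Record finite_dual := FiniteDual {
  finite_dual_val :> A -> k^o;
  finite_dual_valP : finite_dual_val \in finite_dual_pred
}.

HB.instance Definition _ := [isSub for finite_dual_val].
HB.instance Definition _ := [Choice of finite_dual by <:].

Lemma finite_dualP (f : finite_dual) : in_finite_dual f.
Proof. exact: (asboolP _ (finite_dual_valP f)). Qed.

Lemma finite_codimension_ker n (p : {linear A -> 'rV[k]_n}) (I : set A) :
  (forall a, p a = 0 <-> I a) -> finite_codimension I.
Proof.
move=> pI.
pose P r := `[< exists e : 'I_r -> A, row_free (\matrix_(i < r) p (e i)) >].
have P0 : exists r, P r.
  exists 0%N; apply/asboolP; exists (fun=> 0).
  by rewrite /row_free -leqn0 rank_leq_row.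
have Pn r : P r -> (r <= n)%N.
  by case/asboolP=> e /eqP <-; apply: rank_leq_col.
case: (ex_maxnP P0 Pn) => r /asboolP[e]; set M := \matrix_i _ => fM maxr.
have pM a : (p a <= M)%MS.
  apply: contrapT => /negP npM; suff : P r.+1 by move/maxr; rewrite ltnn.
  apply/asboolP; exists (fun i => if unlift ord0 i is Some j then e j else a).
  have -> : (\matrix_(i < r.+1)
      p (if unlift ord0 i is Some j then e j else a)) = col_mx (p a) M.
    apply/row_matrixP => i; rewrite rowK.
    case: (unliftP ord0 i) => [j ->|->].
      have := rowKd j (p a) M; rewrite rowK => <-.
      by congr (row _ _); apply/val_inj.
    have := rowKu ord0 (p a) M; rewrite row_id => {1}<-.
    by congr (row _ _); apply/val_inj.
  have na : p a != 0 by apply: contraNneq npM => ->; apply: sub0mx.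
  have dis : (p a :&: M)%MS = 0.
    apply/eqP/rowV0P => v; rewrite sub_capmx => /andP[/sub_rVP[c ->] cM].
    have [->|c0] := eqVneq c 0; first by rewrite scale0r.
    by move: npM; rewrite -(eqmx_scale _ c0) cM.
  rewrite /row_free -[X in \rank X == _]/(col_mx (p a) M) -(addsmxE (p a) M).
  by rewrite mxrank_disjoint_sum // rank_rV na (eqP fM).
exists r.
pose q (a : A) : 'rV[k]_r := p a *m pinvmx M.
have qlin : linear q by move=> c x y; rewrite /q linearP /= mulmxDl -scalemxAl.
pose qm := GRing.isLinear.Build k A 'rV[k]_r *:%R q qlin.
pose qL : {linear A -> 'rV[k]_r} := HB.pack q qm.
have qM a : q a *m M = p a by rewrite mulmxKpV.
exists qL; split=> [v|a]; last first.
  rewrite -pI; split=> [/= qa0|pa0]; first by rewrite -qM qa0 mul0mx.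
  by rewrite /= /q pa0 mul0mx.
exists (\sum_i v 0 i *: e i); apply: (row_free_inj fM).
rewrite /= qM linear_sum /= mulmx_sum_row.
by apply: eq_bigr => i _; rewrite linearZ rowK.
Qed.

Fact finite_dual_closed : GRing.subsemimod_closed finite_dual_pred.
Proof.
split; first split.
- apply/asboolP; split; first by move=> c x y; rewrite /= scaler0 addr0.
  exists setT; split=> //.
  exists 0%N, (\0 : {linear A -> 'rV[k]_0}); split=> a.
    by exists 0; apply/rowP=> -[].
  by split=> // _; apply/rowP=> -[].
- move=> f g /asboolP[flin [I [Iid [n [p [_ pI]]] fI]]].
  move=> /asboolP[glin [J [Jid [m [q [_ qJ]]] gJ]]].
  apply/asboolP; split.
    by move=> c x y; rewrite !addrfctE flin glin scalerDr addrACA.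
  exists (I `&` J)%classic; split.
  + split=> [|x y [Ix Jx] [Iy Jy]|a x [Ix Jx]|a x [Ix Jx]].
    * by split; apply: ideal0.
    * by split; apply: idealD.
    * by split; apply: idealMl.
    * by split; apply: idealMr.
  + pose r (a : A) : 'rV[k]_(n + m) := row_mx (p a) (q a).
    have rlin : linear r.
      by move=> c x y; rewrite /r !linearP /= -add_row_mx -scale_row_mx.
    pose rm := GRing.isLinear.Build k A 'rV[k]_(n + m) *:%R r rlin.
    pose rL : {linear A -> 'rV[k]_(n + m)} := HB.pack r rm.
    apply: (@finite_codimension_ker _ rL) => a; rewrite /= /r; split.
      by rewrite -row_mx0 => /eq_row_mx[pa qa]; split; [apply/pI|apply/qJ].
    by move=> [/pI-> /qJ->]; rewrite row_mx0.
  + by move=> a [/fI fa /gJ ga]; rewrite addrfctE fa ga addr0.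
- move=> c f /asboolP[flin [I [Iid Ifin fI]]]; apply/asboolP; split.
    by move=> d x y; rewrite !scalrfctE flin scalerDr !scalerA mulrC.
  by exists I; split=> // a /fI fa; rewrite scalrfctE fa scaler0.
Qed.

HB.instance Definition _ := GRing.SubChoice_isSubLmodule.Build k (A -> k^o)
  finite_dual_pred finite_dual finite_dual_closed.

HB.instance Definition _ (f : finite_dual) :=
  GRing.isLinear.Build k A k^o *:%R f (finite_dualP f).1.

Lemma finite_dual_ext (f g : finite_dual) : f =1 g -> f = g.
Proof. by move=> fg; apply/val_inj/funext. Qed.

Lemma finite_dualD (f g : finite_dual) a : (f + g) a = f a + g a.
Proof. by []. Qed.

Lemma finite_dualZ c (f : finite_dual) a : (c *: f) a = c *: f a.
Proof. by []. Qed.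

Lemma finite_dual_sum I r (P : pred I) (F : I -> finite_dual) a :
  (\sum_(i <- r | P i) F i) a = \sum_(i <- r | P i) F i a.
Proof. by elim/big_rec2: _ => // i y x _ <-. Qed.

(* The canonical embedding of A° ⊗ A° into the bilinear forms on A. *)
Definition finite_dual_eval2 (t : finite_dual \otimes finite_dual) (a b : A)
  : k^o := tsum (fun f g : finite_dual => f a * g b) t.

Lemma finite_dual_eval2_bilin (a b : A) :
  bilinear_for *:%R *:%R (fun f g : finite_dual => f a * g b : k^o).
Proof.
split=> [g|f] c x y; rewrite finite_dualD finite_dualZ.
  by rewrite mulrDl -scalerAl.
by rewrite mulrDr -scalerAr.
Qed.

Lemma finite_dual_eval2_linear a b : linear (fun t => finite_dual_eval2 t a b).
Proof. exact: tsum_is_linear (finite_dual_eval2_bilin a b). Qed.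

Lemma finite_dual_eval2_sum n (f g : 'I_n -> finite_dual) a b :
  finite_dual_eval2 (\sum_i f i ⊗ g i) a b = \sum_i f i a * g i b.
Proof.
have lin := finite_dual_eval2_linear a b.
pose ev t := finite_dual_eval2 t a b.
have D : {morph ev : s t / s + t}.
  by move=> s t; have := lin 1 s t; rewrite !scale1r.
have Z : finite_dual_eval2 0 a b = 0.
  by have := lin (-1) 0 0; rewrite scaler0 addr0 scaleN1r addNr.
rewrite -/(ev _) (big_morph ev D Z).
by apply: eq_bigr => i _; apply: (tsum_tens (finite_dual_eval2_bilin a b)).
Qed.

Lemma finite_dual_eval2_inj (s t : finite_dual \otimes finite_dual) :
  (forall a b, finite_dual_eval2 s a b = finite_dual_eval2 t a b) -> s = t.
Proof.
move=> st; apply/eqP; rewrite -subr_eq0; apply/eqP.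
have {st} : forall a b, finite_dual_eval2 (s - t) a b = 0.
  move=> a b; have := finite_dual_eval2_linear a b (-1) t s.
  by rewrite !scaleN1r [- t + s]addrC st addNr => ->.
move: (s - t) => {s t} s s0.
have [n [f [g [sE gfree]]]] := tensor_indep s.
have f0 i : f i = 0.
  apply: finite_dual_ext => a; apply: (gfree (fun j => f j a)).
  apply: finite_dual_ext => b; rewrite finite_dual_sum.
  by have := s0 a b; rewrite sE finite_dual_eval2_sum.
rewrite sE big1 // => i _; rewrite f0.
by rewrite -(scale0r 0) tensZl scale0r.
Qed.

Lemma finite_dual_comul_exists (f : finite_dual) :
  exists t, forall a b, finite_dual_eval2 t a b = f (a * b).
Proof.
have [flin [I [Iid [n [p [psurj pI]]] fI]]] := finite_dualP f.
have [e eP] : exists e : 'I_n -> A, forall i, p (e i) = delta_mx 0 i.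
  by exists (fun i => sval (cid (psurj (delta_mx 0 i)))) => i; case: cid.
pose g i (a : A) : k^o := p a 0 i.
have gP i : g i \in finite_dual_pred.
  apply/asboolP; split; first by move=> c x y; rewrite /g linearP !mxE.
  exists I; split=> //; first by exists n, p.
  by move=> a /pI; rewrite /g => ->; rewrite mxE.
pose h i (b : A) : k^o := f (e i * b).
have hP i : h i \in finite_dual_pred.
  apply/asboolP; split.
    by move=> c x y; rewrite /h mulrDr -scalerAr; apply: flin.
  exists I; split=> //; first by exists n, p.
  by move=> a Ia; apply: fI; apply: idealMl.
exists (\sum_i FiniteDual (gP i) ⊗ FiniteDual (hP i)) => a b.
rewrite finite_dual_eval2_sum /=.
have Iab : I ((a - \sum_i p a 0 i *: e i) * b).
  apply: idealMr => //; apply/pI; rewrite linearB linear_sum /=.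
  under eq_bigr do rewrite linearZ /= eP.
  by rewrite -row_sum_delta subrr.
have := fI _ Iab; rewrite mulrBl linearB /= => /eqP; rewrite subr_eq0 => /eqP ->.
rewrite mulr_suml linear_sum /=.
by apply: eq_bigr => i _; rewrite -scalerAl linearZ.
Qed.

(* Δ°(f) is the only tensor with f(ab) = \sum f_1(a) f_2(b); see
   [finite_dual_comulE] and [finite_dual_comul_unique]. *)
Definition finite_dual_comul (f : finite_dual) : finite_dual \otimes finite_dual :=
  sval (cid (finite_dual_comul_exists f)).

Lemma finite_dual_comulE f a b :
  tsum (fun f1 f2 : finite_dual => f1 a * f2 b) (finite_dual_comul f)
  = f (a * b).
Proof. by rewrite /finite_dual_comul; case: cid => t /=; apply. Qed.

Lemma finite_dual_comul_unique (f : finite_dual) t :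
  (forall a b, tsum (fun f1 f2 : finite_dual => f1 a * f2 b) t = f (a * b)) ->
  t = finite_dual_comul f.
Proof.
move=> tf; apply: finite_dual_eval2_inj => a b; rewrite [RHS]finite_dual_comulE.
exact: tf.
Qed.

Fact finite_dual_comul_linear : linear finite_dual_comul.
Proof.
move=> c f g; apply/esym/finite_dual_comul_unique => a b.
by rewrite [LHS]finite_dual_eval2_linear /finite_dual_eval2 !finite_dual_comulE.
Qed.

HB.instance Definition _ := GRing.isLinear.Build k finite_dual
  (finite_dual \otimes finite_dual)%type *:%R
  finite_dual_comul finite_dual_comul_linear.

Definition finite_dual_counit (f : finite_dual) : k^o := f 1.

Fact finite_dual_counit_linear : linear finite_dual_counit.
Proof. by []. Qed.

HB.instance Definition _ := GRing.isLinear.Build k finite_dual k^o *:%R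
  finite_dual_counit finite_dual_counit_linear.

End FiniteDual.

(* Main.v *)
Require Import Defs.
From HB Require Import structures.
From mathcomp Require Import all_boot all_algebra ring.
From mathcomp Require Import boolp classical_sets.

(** Write [H] for the finite dual of [A].  Its elements are functionals, and
    every structure map of [H] is the transpose of one of [A]:
    [f g = (f ⊠ g) \o Delta], the unit is [eps], the reassociator is the
    evaluation [ω(f, g, h) = (f ⊠ g ⊠ h)(Φ)] at [Φ], and the preantipode is
    [T f = f \o S].  Here [⊠] is the tensor product of functionals.

    Tensors over [H] are determined by their values on tuples of elements of
    [A] ([finite_dual_eval2_inj], [eval3_inj]), so each axiom is an equation
    between scalars.  The comultiplication of [H] is the transpose of the
    product of [A], hence so is that of [H ⊗ ... ⊗ H], which is the content of
    [comul_ftens2], [comul_ftens3], [comul_ftens4] and [comul_ftens_pentagon]: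
    a convolution of evaluations at tensors [x] and [y] is the evaluation at
    the product of [x] and [y].  With this rule each axiom for [H] becomes the
    corresponding property of [A], paired with functionals.

    What remains is that the transposes take their values in [H].  A functional
    [f] is in [H] as soon as [f (a b)] is a finite sum of products
    [p_i(a) q_i(b)] ([finite_rank_dual]).  For the product this follows from the
    multiplicativity of [Delta].  For [f \o S] it is the main point, because a
    preantipode is neither multiplicative nor antimultiplicative; it follows
    from the formula [preantipodeM],
      [S (a b) = \sum S (φ^1 b) φ^2 S (a φ^3)]  where [φ = Φ^-1],
    since [f] splits along the three factors.

    The formula is first proved for [b = 1].  The pentagon is rearranged as
    [(A ⊗ Δ ⊗ A)(Φ) (Φ ⊗ 1) (Δ ⊗ A ⊗ A)(φ) = (1 ⊗ φ) (A ⊗ A ⊗ Δ)(Φ)]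
    and the map [w ⊗ x ⊗ y ⊗ z |-> w S(x) y S(a z)] is applied.  In each factor
    that involves [Δ], the two legs of [Δ] meet on the two sides of an [S], so
    that a preantipode axiom replaces them by a counit; as a counit on any leg
    of [Φ] or [φ] gives [1 ⊗ 1] ([counit_1_Phi], [counit_3_Phi],
    [counit_1_Psi]), these factors disappear.  What is left is
    [\sum Φ^1 S(Φ^2) Φ^3 S(a) = \sum S(φ^1) φ^2 S(a φ^3)], whose left-hand side
    is [S a].  The element [b] is then brought in by coassociativity up to
    [φ]. *)

Set Implicit Arguments.
Unset Strict Implicit.
Unset Printing Implicit Defensive.

Import GRing.Theory.
Local Open Scope ring_scope.

(** * Linearity of expressions in tensors *)

Section LinearCalculus.
Variable k : fieldType.
Implicit Types U V W X : lmodType k.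

Lemma linear_idfun U : linear (fun x : U => x).
Proof. by []. Qed.

Lemma linear_compose U V W (g : V -> W) (f : U -> V) :
  linear g -> linear f -> linear (fun x => g (f x)).
Proof. by move=> lg lf c x y; rewrite lf lg. Qed.

Lemma linear_tensl U V W (f : U -> V) (w : W) :
  linear f -> linear (fun x => f x ⊗ w).
Proof. by move=> lf c x y; rewrite lf tensDl tensZl. Qed.

Lemma linear_tensr U V W (f : U -> V) (w : W) :
  linear f -> linear (fun x => w ⊗ f x).
Proof. by move=> lf c x y; rewrite lf tensDr tensZr. Qed.

Lemma linear_mull U (B : algType k) (f : U -> B) (b : B) :
  linear f -> linear (fun x => f x * b).
Proof. by move=> lf c x y; rewrite lf mulrDl scalerAl. Qed.

Lemma linear_mulr U (B : algType k) (f : U -> B) (b : B) :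
  linear f -> linear (fun x => b * f x).
Proof. by move=> lf c x y; rewrite lf mulrDr scalerAr. Qed.

Lemma linear_scalel U V (f : U -> k^o) (v : V) :
  linear f -> linear (fun x => f x *: v).
Proof. by move=> lf c x y; rewrite lf scalerDl scalerA. Qed.

Lemma linear_scaler U V (f : U -> V) (c : k) :
  linear f -> linear (fun x => c *: f x).
Proof. by move=> lf d x y; rewrite lf scalerDr !scalerA mulrC. Qed.

Lemma linear_tsum U V W X (F : U -> V -> W -> X) (t : U \otimes V) :
  (forall u v, linear (F u v)) -> linear (fun x => tsum (fun u v => F u v x) t).
Proof.
move=> lF c x y; rewrite -tsum_scalef -tsum_addf.
by apply: eq_tsum => u v; rewrite lF.
Qed.

Lemma bilinear_of U V W (F : U -> V -> W) :
  (forall v, linear (fun u => F u v)) -> (forall u, linear (F u)) ->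
  bilinear_for *:%R *:%R F.
Proof. by move=> lFl lFr; split=> [v|u]; [apply: lFl|apply: lFr]. Qed.

Lemma linear_tsum_of U V W X (F : U -> V -> W) (f : X -> U \otimes V) :
  (forall v, linear (fun u => F u v)) -> (forall u, linear (F u)) ->
  linear f -> linear (fun x => tsum F (f x)).
Proof.
move=> lFl lFr lf.
exact: (linear_compose (tsum_is_linear (bilinear_of lFl lFr)) lf).
Qed.

Lemma linear_finite_dual_at (A : algType k) U (f : U -> finite_dual A) (a : A) :
  linear f -> linear (fun x => f x a : k^o).
Proof. by move=> lf c x y; rewrite lf. Qed.

End LinearCalculus.

(** [f ⊠ g] is the tensor product of two functionals, followed by the
    identification of [k ⊗ k] with [k]. *)
Definition ftens (k : fieldType) (U V : lmodType k) (f : U -> k^o)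
    (g : V -> k^o) (t : U \otimes V) : k^o := \tsum_(u, v <- t) f u * g v.

Notation "f ⊠ g" := (ftens f g) (at level 40, left associativity) : ring_scope.

Section FunctionalTensor.
Variables (k : fieldType) (U V : lmodType k).
Variables (f : U -> k^o) (g : V -> k^o).
Hypotheses (lf : linear f) (lg : linear g).

Lemma linear_ftens : linear (f ⊠ g).
Proof.
by apply/tsum_is_linear/bilinear_of => ?;
  [apply: linear_mull|apply: linear_mulr].
Qed.

Lemma ftensE u v : (f ⊠ g) (u ⊗ v) = f u * g v.
Proof.
by apply/tsum_tens/bilinear_of => ?; [apply: linear_mull|apply: linear_mulr].
Qed.

End FunctionalTensor.

(** The product of [B ⊗ C] has a name of its own so that expressions in
    iterated tensor powers can be compared without unfolding the algebra
    structures of the successive powers, whose size grows exponentially. *)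
Definition tmul (k : fieldType) (B C : algType k) (s t : B \otimes C) :
  B \otimes C := s * t.

Lemma tmul_tens (k : fieldType) (B C : algType k) (b b' : B) (c c' : C) :
  tmul (b ⊗ c) (b' ⊗ c') = (b * b') ⊗ (c * c').
Proof. exact: tensM. Qed.

Lemma tmulA (k : fieldType) (B C : algType k) : associative (@tmul k B C).
Proof. exact: mulrA. Qed.

Lemma tmul1t (k : fieldType) (B C : algType k) : left_id (1 ⊗ 1) (@tmul k B C).
Proof. exact: mul1r. Qed.

Lemma tmult1 (k : fieldType) (B C : algType k) : right_id (1 ⊗ 1) (@tmul k B C).
Proof. exact: mulr1. Qed.

Lemma tmulZ (k : fieldType) (B C : algType k) (c d : k) (s t : B \otimes C) :
  tmul (c *: s) (d *: t) = (c * d) *: tmul s t.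
Proof. by rewrite /tmul -scalerAl -scalerAr scalerA. Qed.

Lemma linear_tmull (k : fieldType) (B C : algType k) (t : B \otimes C) :
  linear (fun s => tmul s t).
Proof. by move=> c s s'; rewrite /tmul mulrDl scalerAl. Qed.

Lemma linear_tmulr (k : fieldType) (B C : algType k) (s : B \otimes C) :
  linear (fun t => tmul s t).
Proof. by move=> c t t'; rewrite /tmul mulrDr scalerAr. Qed.

(** Linearity in one variable is read off the shape of the expression:
    [linear_tac] peels off tensors, products, scalings and sums, down to maps
    that are known to be linear. *)
Create HintDb linear_maps.
Ltac linear_leaf :=
  solve [auto 2 with linear_maps nocore | exact: linearP | by []].
Ltac linear_step :=
  match goal with
  | |- GRing.linear_for _ (ftens _ _) => refine (linear_ftens _ _)
  | |- GRing.linear_for _ (tsum _) =>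
      refine (tsum_is_linear (bilinear_of _ _)) => ?
  | |- GRing.linear_for _ (fun x => x) => exact: linear_idfun
  | |- GRing.linear_for _ (fun x => ?y ⊗ @?f x) =>
      refine (@linear_tensr _ _ _ _ f y _)
  | |- GRing.linear_for _ (fun x => @?f x ⊗ ?y) =>
      refine (@linear_tensl _ _ _ _ f y _)
  | |- GRing.linear_for _ (fun x => tmul x _) => exact: linear_tmull
  | |- GRing.linear_for _ (fun x => tmul _ x) => exact: linear_tmulr
  | |- GRing.linear_for _ (fun x => tmul (@?f x) ?y) =>
      refine (@linear_compose _ _ _ _ (fun s => tmul s y) f (linear_tmull _) _)
  | |- GRing.linear_for _ (fun x => tmul ?y (@?f x)) =>
      refine (@linear_compose _ _ _ _ (fun s => tmul y s) f (linear_tmulr _) _)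
  | |- GRing.linear_for _ (fun x => ?y * @?f x) =>
      refine (@linear_mulr _ _ _ f y _)
  | |- GRing.linear_for _ (fun x => @?f x * ?y) =>
      refine (@linear_mull _ _ _ f y _)
  | |- GRing.linear_for _ (fun x => ?c *: @?f x) =>
      refine (@linear_scaler _ _ _ f c _)
  | |- GRing.linear_for _ (fun x => @?f x *: ?y) =>
      refine (@linear_scalel _ _ _ f y _)
  | |- GRing.linear_for _ (fun x => tsum (@?F x) ?t) =>
      refine (@linear_tsum _ _ _ _ _ (fun u v x => F x u v) t _) => ? ?
  | |- GRing.linear_for _ (fun x => tsum ?F (@?f x)) =>
      refine (@linear_tsum_of _ _ _ _ _ F f _ _ _) => [?|?|]
  | |- GRing.linear_for _ (fun x => finite_dual_val (@?f x) ?a) =>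
      refine (@linear_finite_dual_at _ _ _ f a _)
  | |- GRing.linear_for _ (fun x => ftens ?g ?h (@?f x)) =>
      refine (@linear_compose _ _ _ _ (ftens g h) f (linear_ftens _ _) _)
  | |- GRing.linear_for _ (fun x => ?g (@?f x)) =>
      refine (@linear_compose _ _ _ _ g f _ _); [linear_leaf|]
  | |- _ => linear_leaf
  end.
Ltac linear_tac := repeat (cbv beta delta [tsum3]; linear_step).

Lemma linear_ext3 (k : fieldType) (U V W X : lmodType k)
    (f g : U \otimes V \otimes W -> X) :
  linear f -> linear g ->
  (forall u v w, f (u ⊗ v ⊗ w) = g (u ⊗ v ⊗ w)) -> f =1 g.
Proof.
move=> lf lg efg; apply: tensor_linear_ext => // t w.
by move: t; apply: tensor_linear_ext => [||u v]; linear_tac.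
Qed.

Lemma linear_ext4 (k : fieldType) (U V W X Y : lmodType k)
    (f g : U \otimes V \otimes W \otimes X -> Y) :
  linear f -> linear g ->
  (forall u v w x, f (u ⊗ v ⊗ w ⊗ x) = g (u ⊗ v ⊗ w ⊗ x)) -> f =1 g.
Proof.
move=> lf lg efg; apply: tensor_linear_ext => // t x.
by move: t; apply: linear_ext3 => [||u v w]; linear_tac.
Qed.

Lemma tsum_apply (k : fieldType) (U V W X : lmodType k) (f : W -> X)
    (F : U -> V -> W) t :
  linear f -> f (tsum F t) = tsum (fun u v => f (F u v)) t.
Proof.
move=> lf; apply: (big_morph f (id1 := 0) (op1 := +%R)) => [x y|].
  by have := lf 1 x y; rewrite !scale1r.
by have := lf (-1) 0 0; rewrite !scaleN1r !addNr.
Qed.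

Lemma tsum_tensK (k : fieldType) (U V : lmodType k) (t : U \otimes V) :
  \tsum_(u, v <- t) u ⊗ v = t.
Proof. exact/esym/tensor_decomp. Qed.

Section ScalarSums.
Variables (k : fieldType) (B : pzSemiRingType) (U V : lmodType k).

Lemma tsum_mull (F : U -> V -> B) t b :
  tsum F t * b = \tsum_(u, v <- t) F u v * b.
Proof. exact: mulr_suml. Qed.

Lemma tsum_mulr (F : U -> V -> B) t b :
  b * tsum F t = \tsum_(u, v <- t) b * F u v.
Proof. exact: mulr_sumr. Qed.

End ScalarSums.

Section ScalarSums3.
Variables (k : fieldType) (B : pzSemiRingType) (U V W : lmodType k).

Lemma tsum3_mull (F : U -> V -> W -> B) t b :
  tsum3 F t * b = \tsum_(u, v, w <- t) F u v w * b.
Proof.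
by rewrite /tsum3 tsum_mull; apply: eq_tsum => ? ?; rewrite tsum_mull.
Qed.

Lemma tsum3_mulr (F : U -> V -> W -> B) t b :
  b * tsum3 F t = \tsum_(u, v, w <- t) b * F u v w.
Proof.
by rewrite /tsum3 tsum_mulr; apply: eq_tsum => ? ?; rewrite tsum_mulr.
Qed.

End ScalarSums3.

Lemma eq_tsum3 (k : fieldType) (U V W : lmodType k) (X : nmodType)
    (F G : U -> V -> W -> X) t :
  (forall u v w, F u v w = G u v w) -> tsum3 F t = tsum3 G t.
Proof. by move=> eFG; apply: eq_tsum => ? ?; apply: eq_tsum => ? ?. Qed.

Lemma tsum_pure (k : fieldType) (U V W : lmodType k) (F : U -> V -> W) u v :
  (forall v, linear (fun u => F u v)) -> (forall u, linear (F u)) ->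
  tsum F (u ⊗ v) = F u v.
Proof. by move=> lFl lFr; apply: tsum_tens; apply: bilinear_of. Qed.

Lemma tsum3_pure (k : fieldType) (U V W X : lmodType k)
    (F : U -> V -> W -> X) u v w :
  (forall v w, linear (fun u => F u v w)) ->
  (forall u w, linear (fun v => F u v w)) ->
  (forall u v, linear (fun w => F u v w)) ->
  tsum3 F (u ⊗ v ⊗ w) = F u v w.
Proof.
move=> lF1 lF2 lF3; rewrite /tsum3 !tsum_pure //.
all: by move=> ?; linear_tac.
Qed.

Lemma tsum3_apply (k : fieldType) (U V W X Y : lmodType k) (f : X -> Y)
    (F : U -> V -> W -> X) t :
  linear f -> f (tsum3 F t) = \tsum_(u, v, w <- t) f (F u v w).
Proof.
move=> lf; rewrite /tsum3 tsum_apply //.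
by apply: eq_tsum => x w; rewrite tsum_apply.
Qed.

(** A product of sums over different tensors is one nested sum; each call
    brings the leftmost factor outside and matches it with the outermost sum on
    the other side. *)
Ltac separate_sums :=
  rewrite -?mulrA ?(tsum3_mull, tsum_mull) ?tsum3_mulr ?tsum_mulr;
  (first [apply: eq_tsum3 => ? ? ? | apply: eq_tsum => ? ?]).

(** * Comultiplication and counit on one leg of a tensor *)

Section Preantipode.
Variables (k : fieldType) (A : algType k).
Variables (Delta : {lrmorphism A -> A \otimes A}) (eps : {lrmorphism A -> k^o}).
Implicit Types (a b : A) (X Y : A \otimes A \otimes A).
Local Notation "A ^2" := (A \otimes A)%type (at level 8, format "A ^2").
Local Notation "A ^3" := (A \otimes A \otimes A)%type
  (at level 8, format "A ^3").
Local Notation "A ^4" := (A \otimes A \otimes A \otimes A)%type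
  (at level 8, format "A ^4").

(** In [Delta_i], [counit_i] and [counit4_i] below, the index is the leg of the
    tensor on which [Delta] or [eps] acts. *)
Definition one_tensor X : A^4 := \tsum_(x, y, z <- X) (1 : A) ⊗ x ⊗ y ⊗ z.
Definition Delta_1 X : A^4 := \tsum_(x, y, z <- X) Delta x ⊗ y ⊗ z.
Definition Delta_2 X : A^4 :=
  \tsum_(x, y, z <- X) \tsum_(y1, y2 <- Delta y) x ⊗ y1 ⊗ y2 ⊗ z.
Definition Delta_3 X : A^4 :=
  \tsum_(x, y, z <- X) \tsum_(z1, z2 <- Delta z) x ⊗ y ⊗ z1 ⊗ z2.

Lemma linear_one_tensor : linear one_tensor.
Proof. by rewrite /one_tensor; linear_tac. Qed.

Lemma linear_Delta_1 : linear Delta_1.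
Proof. by rewrite /Delta_1; linear_tac. Qed.

Lemma linear_Delta_2 : linear Delta_2.
Proof. by rewrite /Delta_2; linear_tac. Qed.

Lemma linear_Delta_3 : linear Delta_3.
Proof. by rewrite /Delta_3; linear_tac. Qed.

Definition counit_1 X : A^2 :=
  \tsum_(x, y, z <- X) (eps x : k) *: (y ⊗ z : A^2).
Definition counit_2 X : A^2 :=
  \tsum_(x, y, z <- X) (eps y : k) *: (x ⊗ z : A^2).
Definition counit_3 X : A^2 :=
  \tsum_(x, y, z <- X) (eps z : k) *: (x ⊗ y : A^2).
Definition counit4_2 (W : A^4) : A^3 :=
  \tsum_(s, z <- W) \tsum_(w, x, y <- s) (eps x : k) *: (w ⊗ y ⊗ z : A^3).
Definition counit4_3 (W : A^4) : A^3 :=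
  \tsum_(s, z <- W) \tsum_(w, x, y <- s) (eps y : k) *: (w ⊗ x ⊗ z : A^3).

Lemma linear_counit_1 : linear counit_1.
Proof. by rewrite /counit_1; linear_tac. Qed.

Lemma linear_counit_2 : linear counit_2.
Proof. by rewrite /counit_2; linear_tac. Qed.

Lemma linear_counit_3 : linear counit_3.
Proof. by rewrite /counit_3; linear_tac. Qed.

Lemma linear_counit4_2 : linear counit4_2.
Proof. by rewrite /counit4_2; linear_tac. Qed.

Lemma linear_counit4_3 : linear counit4_3.
Proof. by rewrite /counit4_3; linear_tac. Qed.

Hint Resolve linear_one_tensor linear_Delta_1 linear_Delta_2 linear_Delta_3
  linear_counit_1 linear_counit_2 linear_counit_3 linear_counit4_2
  linear_counit4_3 : linear_maps.

Lemma one_tensorE x y z : one_tensor (x ⊗ y ⊗ z) = 1 ⊗ x ⊗ y ⊗ z.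
Proof. by apply: tsum3_pure => ? ?; linear_tac. Qed.

Lemma Delta_1E x y z : Delta_1 (x ⊗ y ⊗ z) = Delta x ⊗ y ⊗ z.
Proof. by apply: tsum3_pure => ? ?; linear_tac. Qed.

Lemma Delta_2E x y z :
  Delta_2 (x ⊗ y ⊗ z) = \tsum_(y1, y2 <- Delta y) x ⊗ y1 ⊗ y2 ⊗ z.
Proof. by apply: tsum3_pure => ? ?; linear_tac. Qed.

Lemma Delta_3E x y z :
  Delta_3 (x ⊗ y ⊗ z) = \tsum_(z1, z2 <- Delta z) x ⊗ y ⊗ z1 ⊗ z2.
Proof. by apply: tsum3_pure => ? ?; linear_tac. Qed.

Lemma counit_1E x y z : counit_1 (x ⊗ y ⊗ z) = (eps x : k) *: (y ⊗ z : A^2).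
Proof. by apply: tsum3_pure => ? ?; linear_tac. Qed.

Lemma counit_2E x y z : counit_2 (x ⊗ y ⊗ z) = (eps y : k) *: (x ⊗ z).
Proof. by apply: tsum3_pure => ? ?; linear_tac. Qed.

Lemma counit_3E x y z : counit_3 (x ⊗ y ⊗ z) = (eps z : k) *: (x ⊗ y).
Proof. by apply: tsum3_pure => ? ?; linear_tac. Qed.

Lemma counit4_2E w x y z :
  counit4_2 (w ⊗ x ⊗ y ⊗ z) = (eps x : k) *: (w ⊗ y ⊗ z).
Proof.
rewrite /counit4_2 tsum_pure; do ?by move=> ?; linear_tac.
by apply: tsum3_pure => ? ?; linear_tac.
Qed.

Lemma counit4_3E w x y z :
  counit4_3 (w ⊗ x ⊗ y ⊗ z) = (eps y : k) *: (w ⊗ x ⊗ z).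
Proof.
rewrite /counit4_3 tsum_pure; do ?by move=> ?; linear_tac.
by apply: tsum3_pure => ? ?; linear_tac.
Qed.

Lemma one_tensorM X Y :
  one_tensor (tmul X Y) = tmul (one_tensor X) (one_tensor Y).
Proof.
move: X; apply: linear_ext3; [linear_tac..|move=> x y z].
move: Y; apply: linear_ext3; [linear_tac..|move=> x' y' z'].
by rewrite tmul_tens ?tensM !one_tensorE tmul_tens ?tensM mulr1.
Qed.

Lemma Delta_1M X Y : Delta_1 (tmul X Y) = tmul (Delta_1 X) (Delta_1 Y).
Proof.
move: X; apply: linear_ext3; [linear_tac..|move=> x y z].
move: Y; apply: linear_ext3; [linear_tac..|move=> x' y' z'].
by rewrite tmul_tens ?tensM !Delta_1E rmorphM tmul_tens ?tensM.
Qed.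

Lemma counit_1M X Y : counit_1 (tmul X Y) = tmul (counit_1 X) (counit_1 Y).
Proof.
move: X; apply: linear_ext3; [linear_tac..|move=> x y z].
move: Y; apply: linear_ext3; [linear_tac..|move=> x' y' z'].
by rewrite tmul_tens ?tensM !counit_1E tmulZ tmul_tens rmorphM.
Qed.

Lemma counit4_2M V W : counit4_2 (tmul V W) = tmul (counit4_2 V) (counit4_2 W).
Proof.
move: V; apply: linear_ext4; [linear_tac..|move=> w x y z].
move: W; apply: linear_ext4; [linear_tac..|move=> w' x' y' z'].
by rewrite tmul_tens ?tensM !counit4_2E tmulZ tmul_tens ?tensM rmorphM.
Qed.

Lemma counit4_3M V W : counit4_3 (tmul V W) = tmul (counit4_3 V) (counit4_3 W).
Proof.
move: V; apply: linear_ext4; [linear_tac..|move=> w x y z].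
move: W; apply: linear_ext4; [linear_tac..|move=> w' x' y' z'].
by rewrite tmul_tens ?tensM !counit4_3E tmulZ tmul_tens ?tensM rmorphM.
Qed.

(** * The counit on the legs of the reassociator *)

Hypothesis counitl : forall a, \tsum_(a1, a2 <- Delta a) eps a1 *: a2 = a.
Hypothesis counitr : forall a, \tsum_(a1, a2 <- Delta a) eps a2 *: a1 = a.

Lemma counit4_3_Delta_2 X : counit4_3 (Delta_2 X) = X.
Proof.
move: X; apply: linear_ext3; [linear_tac..|move=> x y z].
rewrite Delta_2E tsum_apply; last by linear_tac.
rewrite -[in RHS](counitr y) (tsum_apply (f := fun a => x ⊗ a ⊗ z));
  last by linear_tac.
by apply: eq_tsum => y1 y2; rewrite counit4_3E tensZr tensZl.
Qed.

Lemma counit4_3_Delta_3 X : counit4_3 (Delta_3 X) = X.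
Proof.
move: X; apply: linear_ext3; [linear_tac..|move=> x y z].
rewrite Delta_3E tsum_apply; last by linear_tac.
rewrite -[in RHS](counitl z) (tsum_apply (f := fun a => x ⊗ y ⊗ a));
  last by linear_tac.
by apply: eq_tsum => z1 z2; rewrite counit4_3E tensZr.
Qed.

Lemma counit4_2_Delta_2 X : counit4_2 (Delta_2 X) = X.
Proof.
move: X; apply: linear_ext3; [linear_tac..|move=> x y z].
rewrite Delta_2E tsum_apply; last by linear_tac.
rewrite -[in RHS](counitl y) (tsum_apply (f := fun a => x ⊗ a ⊗ z));
  last by linear_tac.
by apply: eq_tsum => y1 y2; rewrite counit4_2E tensZr tensZl.
Qed.

Lemma counit4_2_Delta_1 X : counit4_2 (Delta_1 X) = X.
Proof.
move: X; apply: linear_ext3; [linear_tac..|move=> x y z].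
rewrite Delta_1E -[in RHS](counitr x) -[in LHS](tsum_tensK (Delta x)).
rewrite (tsum_apply (f := fun a => a ⊗ y ⊗ z)); last by linear_tac.
rewrite (tsum_apply (f := fun t => counit4_2 (t ⊗ y ⊗ z)));
  last by linear_tac.
by apply: eq_tsum => x1 x2; rewrite counit4_2E !tensZl.
Qed.

Definition one_tensor2 (t : A^2) : A^3 := \tsum_(x, y <- t) (1 : A) ⊗ x ⊗ y.
Definition Delta2_1 (t : A^2) : A^3 := \tsum_(x, y <- t) Delta x ⊗ y.
Definition Delta2_2 (t : A^2) : A^3 :=
  \tsum_(x, y <- t) \tsum_(y1, y2 <- Delta y) x ⊗ y1 ⊗ y2.

Lemma linear_one_tensor2 : linear one_tensor2.
Proof. by rewrite /one_tensor2; linear_tac. Qed.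

Lemma linear_Delta2_1 : linear Delta2_1.
Proof. by rewrite /Delta2_1; linear_tac. Qed.

Lemma linear_Delta2_2 : linear Delta2_2.
Proof. by rewrite /Delta2_2; linear_tac. Qed.

Hint Resolve linear_one_tensor2 linear_Delta2_1 linear_Delta2_2 : linear_maps.

Lemma one_tensor2E x y : one_tensor2 (x ⊗ y) = 1 ⊗ x ⊗ y.
Proof. by apply: tsum_pure => ?; linear_tac. Qed.

Lemma Delta2_1E x y : Delta2_1 (x ⊗ y) = Delta x ⊗ y.
Proof. by apply: tsum_pure => ?; linear_tac. Qed.

Lemma Delta2_2E x y : Delta2_2 (x ⊗ y) = \tsum_(y1, y2 <- Delta y) x ⊗ y1 ⊗ y2.
Proof. by apply: tsum_pure => ?; linear_tac. Qed.

Lemma counit4_3_one_tensor X :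
  counit4_3 (one_tensor X) = one_tensor2 (counit_2 X).
Proof.
move: X; apply: linear_ext3; [linear_tac..|move=> x y z].
rewrite one_tensorE counit4_3E counit_2E.
by rewrite (GRing.scalable_linear linear_one_tensor2) one_tensor2E.
Qed.

Lemma counit4_3_tensor_one X : counit4_3 (X ⊗ 1) = counit_3 X ⊗ 1.
Proof.
move: X; apply: linear_ext3; [linear_tac..|move=> x y z].
by rewrite counit4_3E counit_3E tensZl.
Qed.

Lemma counit4_3_Delta_1 X : counit4_3 (Delta_1 X) = Delta2_1 (counit_2 X).
Proof.
move: X; apply: linear_ext3; [linear_tac..|move=> x y z].
rewrite Delta_1E counit_2E (GRing.scalable_linear linear_Delta2_1) Delta2_1E.
move: (Delta x); apply: tensor_linear_ext; [linear_tac..|move=> x1 x2].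
by rewrite counit4_3E.
Qed.

Lemma counit4_2_one_tensor X :
  counit4_2 (one_tensor X) = one_tensor2 (counit_1 X).
Proof.
move: X; apply: linear_ext3; [linear_tac..|move=> x y z].
rewrite one_tensorE counit4_2E counit_1E.
by rewrite (GRing.scalable_linear linear_one_tensor2) one_tensor2E.
Qed.

Lemma counit4_2_tensor_one X : counit4_2 (X ⊗ 1) = counit_2 X ⊗ 1.
Proof.
move: X; apply: linear_ext3; [linear_tac..|move=> x y z].
by rewrite counit4_2E counit_2E tensZl.
Qed.

Lemma counit4_2_Delta_3 X : counit4_2 (Delta_3 X) = Delta2_2 (counit_2 X).
Proof.
move: X; apply: linear_ext3; [linear_tac..|move=> x y z].
rewrite Delta_3E counit_2E (GRing.scalable_linear linear_Delta2_2) Delta2_2E.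
rewrite tsum_apply; last by linear_tac.
by rewrite -[RHS]tsum_scalef; apply: eq_tsum => z1 z2; rewrite counit4_2E.
Qed.

Lemma counit_3_tensor_one t : counit_3 (t ⊗ 1) = t.
Proof.
move: t; apply: tensor_linear_ext; [linear_tac..|move=> x y].
by rewrite counit_3E rmorph1 scale1r.
Qed.

Lemma counit_1_one_tensor2 t : counit_1 (one_tensor2 t) = t.
Proof.
move: t; apply: tensor_linear_ext; [linear_tac..|move=> x y].
by rewrite one_tensor2E counit_1E rmorph1 scale1r.
Qed.

Lemma Delta2_1_1 : Delta2_1 (1 ⊗ 1) = 1 ⊗ 1 ⊗ 1.
Proof. by rewrite Delta2_1E rmorph1. Qed.

Lemma Delta2_2_1 : Delta2_2 (1 ⊗ 1) = 1 ⊗ 1 ⊗ 1.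
Proof.
by rewrite Delta2_2E rmorph1 tens1 tsum_pure // => ?; linear_tac.
Qed.

Variables (Phi Psi : A^3).
Hypotheses (PhiK : tmul Psi Phi = 1 ⊗ 1 ⊗ 1) (PsiK : tmul Phi Psi = 1 ⊗ 1 ⊗ 1).
Hypothesis pentagon : tmul (tmul (one_tensor Phi) (Delta_2 Phi)) (Phi ⊗ 1)
  = tmul (Delta_3 Phi) (Delta_1 Phi).
Hypothesis counit_2_Phi : counit_2 Phi = 1 ⊗ 1.

(** Under [eps] on its third leg, the pentagon reads
    [Φ ((A ⊗ A ⊗ ε)(Φ) ⊗ 1) = Φ], because [eps] on the middle leg of [Φ] is
    known to give [1 ⊗ 1]. *)
Lemma counit_3_Phi : counit_3 Phi = 1 ⊗ 1.
Proof.
have := congr1 counit4_3 pentagon; rewrite !counit4_3M.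
rewrite counit4_3_one_tensor counit4_3_Delta_2 counit4_3_tensor_one.
rewrite counit4_3_Delta_3 counit4_3_Delta_1 counit_2_Phi.
rewrite one_tensor2E Delta2_1_1.
rewrite tmul1t => /(congr1 (tmul Psi)); rewrite !tmulA PhiK tmul1t tmul1t.
by move/(congr1 counit_3); rewrite !counit_3_tensor_one.
Qed.

(** Under [eps] on its second leg, the pentagon reads
    [(1 ⊗ (ε ⊗ A ⊗ A)(Φ)) Φ = Φ]. *)
Lemma counit_1_Phi : counit_1 Phi = 1 ⊗ 1.
Proof.
have := congr1 counit4_2 pentagon; rewrite !counit4_2M.
rewrite counit4_2_one_tensor counit4_2_Delta_2 counit4_2_tensor_one.
rewrite counit4_2_Delta_3 counit4_2_Delta_1 counit_2_Phi Delta2_2_1.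
rewrite tmult1 tmul1t => /(congr1 (fun t => tmul t Psi)).
rewrite -tmulA PsiK tmult1 => /(congr1 counit_1).
by rewrite counit_1_one_tensor2 counit_1E rmorph1 scale1r.
Qed.

Lemma counit_1_Psi : counit_1 Psi = 1 ⊗ 1.
Proof.
have := congr1 counit_1 PhiK; rewrite counit_1M counit_1_Phi tmult1 => ->.
by rewrite counit_1E rmorph1 scale1r.
Qed.

(** The factors [1 ⊗ Φ] and [(Δ ⊗ A ⊗ A)(Φ)] of the pentagon are inverted, so
    that each of the three factors of the form [Δ_i] can be absorbed by a
    preantipode axiom under [sandwich4]. *)
Lemma pentagon_inverse :
  tmul (tmul (Delta_2 Phi) (Phi ⊗ 1)) (Delta_1 Psi)
  = tmul (one_tensor Psi) (Delta_3 Phi).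
Proof.
have := congr1 (fun W => tmul (tmul (one_tensor Psi) W) (Delta_1 Psi)) pentagon.
rewrite !tmulA -one_tensorM PhiK one_tensorE !tmul1t => ->.
by rewrite -!tmulA -Delta_1M PsiK Delta_1E rmorph1 tmult1.
Qed.

(** * The preantipode of a product *)

Variable S : {linear A -> A}.
Hypothesis preantipode_l : forall a b,
  \tsum_(a1, a2 <- Delta a) a1 * S (b * a2) = eps a *: S b.
Hypothesis preantipode_r : forall a b,
  \tsum_(a1, a2 <- Delta a) S (a1 * b) * a2 = eps a *: S b.
Hypothesis preantipode_Phi : \tsum_(x, y, z <- Phi) x * S y * z = 1.

Definition sandwich4 a (W : A^4) : A :=
  \tsum_(s, z <- W) \tsum_(w, x, y <- s) w * S x * y * S (a * z).

Definition sandwich3 a X : A := \tsum_(x, y, z <- X) S x * y * S (a * z).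

Lemma linear_sandwich4 a : linear (sandwich4 a).
Proof. by rewrite /sandwich4; linear_tac. Qed.

Lemma linear_sandwich3 a : linear (sandwich3 a).
Proof. by rewrite /sandwich3; linear_tac. Qed.

Hint Resolve linear_sandwich4 linear_sandwich3 : linear_maps.

Lemma sandwich4E a w x y z :
  sandwich4 a (w ⊗ x ⊗ y ⊗ z) = w * S x * y * S (a * z).
Proof.
rewrite /sandwich4 tsum_pure; do ?by move=> ?; linear_tac.
by apply: tsum3_pure => ? ?; linear_tac.
Qed.

Lemma sandwich3E a x y z : sandwich3 a (x ⊗ y ⊗ z) = S x * y * S (a * z).
Proof. by apply: tsum3_pure => ? ?; linear_tac. Qed.

Definition ones_inside (t : A^2) : A^4 :=
  \tsum_(x, y <- t) x ⊗ (1 : A) ⊗ (1 : A) ⊗ y.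
Definition ones_left (t : A^2) : A^4 :=
  \tsum_(x, y <- t) (1 : A) ⊗ (1 : A) ⊗ x ⊗ y.
Definition ones_right (t : A^2) : A^4 :=
  \tsum_(x, y <- t) x ⊗ y ⊗ (1 : A) ⊗ (1 : A).

Lemma linear_ones_inside : linear ones_inside.
Proof. by rewrite /ones_inside; linear_tac. Qed.

Lemma linear_ones_left : linear ones_left.
Proof. by rewrite /ones_left; linear_tac. Qed.

Lemma linear_ones_right : linear ones_right.
Proof. by rewrite /ones_right; linear_tac. Qed.

Hint Resolve linear_ones_inside linear_ones_left linear_ones_right :
  linear_maps.

Lemma ones_insideE x y : ones_inside (x ⊗ y) = x ⊗ 1 ⊗ 1 ⊗ y.
Proof. by apply: tsum_pure => ?; linear_tac. Qed.

Lemma ones_leftE x y : ones_left (x ⊗ y) = 1 ⊗ 1 ⊗ x ⊗ y.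
Proof. by apply: tsum_pure => ?; linear_tac. Qed.

Lemma ones_rightE x y : ones_right (x ⊗ y) = x ⊗ y ⊗ 1 ⊗ 1.
Proof. by apply: tsum_pure => ?; linear_tac. Qed.

(** The two legs of [Delta y] stand on either side of the closing end of the
    first [S], as in [\sum S (y1 b) y2 = eps y *: S b]. *)
Lemma sandwich4_Delta_2 a X W :
  sandwich4 a (tmul (Delta_2 X) W) =
  sandwich4 a (tmul (ones_inside (counit_2 X)) W).
Proof.
move: X; apply: linear_ext3; [linear_tac..|move=> x y z].
move: W; apply: linear_ext4; [linear_tac..|move=> w1 w2 w3 w4].
have lM : linear (fun s => sandwich4 a (tmul s (w1 ⊗ w2 ⊗ w3 ⊗ w4))).
  by linear_tac.
rewrite Delta_2E counit_2E (GRing.scalable_linear linear_ones_inside).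
rewrite (GRing.scalable_linear lM) (tsum_apply _ _ lM) ones_insideE.
rewrite tmul_tens ?tensM sandwich4E !mul1r.
transitivity (x * w1 * (\tsum_(y1, y2 <- Delta y) S (y1 * w2) * y2)
              * (w3 * S (a * (z * w4)))).
  rewrite tsum_mulr tsum_mull; apply: eq_tsum => y1 y2.
  by rewrite tmul_tens ?tensM sandwich4E !mulrA.
by rewrite preantipode_r -scalerAr -scalerAl !mulrA.
Qed.

(** Here the legs of [Delta x] meet as in [\sum x1 S (b x2) = eps x *: S b]:
    a factor [W] on the left puts its second leg in front of [x2] inside [S]. *)
Lemma sandwich4_Delta_1 a W X :
  sandwich4 a (tmul W (Delta_1 X)) =
  sandwich4 a (tmul W (ones_left (counit_1 X))).
Proof.
move: X; apply: linear_ext3; [linear_tac..|move=> x y z].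
move: W; apply: linear_ext4; [linear_tac..|move=> w1 w2 w3 w4].
have lM : linear (fun s => sandwich4 a (tmul (w1 ⊗ w2 ⊗ w3 ⊗ w4) s)).
  by linear_tac.
rewrite Delta_1E counit_1E (GRing.scalable_linear linear_ones_left).
rewrite (GRing.scalable_linear lM) ones_leftE.
rewrite [in RHS]tmul_tens ?tensM sandwich4E !mulr1.
transitivity (w1 * (\tsum_(x1, x2 <- Delta x) x1 * S (w2 * x2))
              * (w3 * y * S (a * (w4 * z)))).
  rewrite tsum_mulr tsum_mull -[in LHS](tsum_tensK (Delta x)).
  rewrite (tsum_apply
    (f := fun s => sandwich4 a (tmul (w1 ⊗ w2 ⊗ w3 ⊗ w4) (s ⊗ y ⊗ z)))).
    by apply: eq_tsum => x1 x2; rewrite tmul_tens ?tensM sandwich4E !mulrA.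
  by linear_tac.
by rewrite preantipode_l -scalerAr -scalerAl !mulrA.
Qed.

(** The same axiom for the second [S], whose argument already contains [a]. *)
Lemma sandwich4_Delta_3 a W X :
  sandwich4 a (tmul W (Delta_3 X)) =
  sandwich4 a (tmul W (ones_right (counit_3 X))).
Proof.
move: X; apply: linear_ext3; [linear_tac..|move=> x y z].
move: W; apply: linear_ext4; [linear_tac..|move=> w1 w2 w3 w4].
have lM : linear (fun s => sandwich4 a (tmul (w1 ⊗ w2 ⊗ w3 ⊗ w4) s)).
  by linear_tac.
rewrite Delta_3E counit_3E (GRing.scalable_linear linear_ones_right).
rewrite (GRing.scalable_linear lM) (tsum_apply _ _ lM) ones_rightE.
rewrite tmul_tens ?tensM sandwich4E !mulr1.
transitivity (w1 * x * S (w2 * y) * w3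
              * (\tsum_(z1, z2 <- Delta z) z1 * S (a * w4 * z2))).
  rewrite tsum_mulr; apply: eq_tsum => z1 z2.
  by rewrite tmul_tens ?tensM sandwich4E ?mulrA.
by rewrite preantipode_l -scalerAr ?mulrA.
Qed.

(** The case [b = 1] of the formula for [S (a b)]: after the counits have
    removed the three factors that involve [Delta], the rearranged pentagon
    reads [(\sum Φ^1 S(Φ^2) Φ^3) S(a) = \sum S(Ψ^1) Ψ^2 S(a Ψ^3)]. *)
Lemma sandwich3_Psi a : sandwich3 a Psi = S a.
Proof.
have := congr1 (sandwich4 a) pentagon_inverse.
rewrite sandwich4_Delta_1 sandwich4_Delta_3 counit_1_Psi counit_3_Phi.
rewrite ones_leftE ones_rightE !tmult1 sandwich4_Delta_2 counit_2_Phi.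
rewrite ones_insideE tmul1t.
have -> X : sandwich4 a (one_tensor X) = sandwich3 a X.
  move: X; apply: linear_ext3; [linear_tac..|move=> x y z].
  by rewrite one_tensorE sandwich4E sandwich3E mul1r.
move=> <-.
have -> X : sandwich4 a (X ⊗ 1) = (\tsum_(x, y, z <- X) x * S y * z) * S a.
  move: X; apply: linear_ext3; [linear_tac..|move=> x y z].
  by rewrite sandwich4E mulr1 tsum3_pure // => ? ?; linear_tac.
by rewrite preantipode_Phi mul1r.
Qed.

Definition coassoc_l b : A^3 := \tsum_(b1, b2 <- Delta b) Delta b1 ⊗ b2.
Definition coassoc_r b : A^3 :=
  \tsum_(b1, b2 <- Delta b) \tsum_(b21, b22 <- Delta b2) b1 ⊗ b21 ⊗ b22.

Hypothesis coassocPsi :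
  forall b, tmul Psi (coassoc_r b) = tmul (coassoc_l b) Psi.

(** The legs [b21], [b22] of the second leg of [Delta b] stand around the second
    [S] and cancel, which leaves [b] inside the first [S]. *)
Lemma sandwich3_coassoc_r a b X :
  sandwich3 a (tmul X (coassoc_r b)) =
  \tsum_(x, y, z <- X) S (x * b) * y * S (a * z).
Proof.
move: X; apply: linear_ext3; [linear_tac..|move=> x y z].
have lM : linear (fun s => sandwich3 a (tmul (x ⊗ y ⊗ z) s)) by linear_tac.
rewrite /coassoc_r (tsum_apply _ _ lM) tsum3_pure;
  do ?by move=> ? ?; linear_tac.
rewrite -[in RHS](counitr b).
rewrite (tsum_apply (f := fun b => S (x * b) * y * S (a * z)));
  last by linear_tac.
apply: eq_tsum => b1 b2; rewrite (tsum_apply _ _ lM).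
transitivity (S (x * b1) * y *
              \tsum_(c1, c2 <- Delta b2) c1 * S (a * z * c2)).
  rewrite tsum_mulr; apply: eq_tsum => c1 c2.
  by rewrite tmul_tens ?tensM sandwich3E !mulrA.
by rewrite preantipode_l -!scalerAr linearZ -!scalerAl.
Qed.

(** On the other side of [X], it is the first leg of [Delta b] that cancels,
    around the first [S], which leaves [b] inside the second one. *)
Lemma sandwich3_coassoc_l a b X :
  sandwich3 a (tmul (coassoc_l b) X) = sandwich3 (a * b) X.
Proof.
move: X; apply: linear_ext3; [linear_tac..|move=> x y z].
have lM : linear (fun s => sandwich3 a (tmul s (x ⊗ y ⊗ z))) by linear_tac.
rewrite /coassoc_l (tsum_apply _ _ lM) sandwich3E.
rewrite -[in RHS](counitl b).
rewrite (tsum_apply (f := fun b => S x * y * S (a * b * z)));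
  last by linear_tac.
apply: eq_tsum => b1 b2.
transitivity ((\tsum_(c1, c2 <- Delta b1) S (c1 * x) * c2) *
              (y * S (a * b2 * z))).
  rewrite tsum_mull -[in LHS](tsum_tensK (Delta b1)).
  rewrite (tsum_apply (f := fun s => sandwich3 a (tmul (s ⊗ b2) (x ⊗ y ⊗ z)))).
    by apply: eq_tsum => c1 c2; rewrite tmul_tens ?tensM sandwich3E !mulrA.
  by linear_tac.
by rewrite preantipode_r -!scalerAr -!scalerAl linearZ -!scalerAr !mulrA.
Qed.

(** Coassociativity up to [Psi] carries [b] from the first [S] to the second
    one, where it joins [a]; the case [b = 1] then applies to [a * b]. *)
Lemma preantipodeM a b :
  S (a * b) = \tsum_(x, y, z <- Psi) S (x * b) * y * S (a * z).
Proof.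
by rewrite -sandwich3_coassoc_r coassocPsi sandwich3_coassoc_l sandwich3_Psi.
Qed.

End Preantipode.

(** * Membership in the finite dual *)

Definition linear_pack (k : fieldType) (U V : lmodType k) (f : U -> V)
    (lf : linear f) : {linear U -> V} :=
  HB.pack f (GRing.isLinear.Build k U V *:%R f lf).

Section FiniteRank.
Variables (k : fieldType) (A : algType k).

(** [F] is the bilinear form of a tensor in the algebraic square of the full
    dual of [A]. *)
Definition finite_rank (F : A -> A -> k^o) : Prop :=
  exists s : seq ({linear A -> k^o} * {linear A -> k^o}),
    forall a b, F a b = \sum_(p <- s) p.1 a * p.2 b.

Lemma finite_rank_mul (p q : A -> k^o) :
  linear p -> linear q -> finite_rank (fun a b => p a * q b).
Proof.
move=> lp lq; exists [:: (linear_pack lp, linear_pack lq)] => a b.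
by rewrite big_seq1.
Qed.

Lemma finite_rank_tsum (U V : lmodType k) (F : U -> V -> A -> A -> k^o) t :
  (forall u v, finite_rank (F u v)) ->
  finite_rank (fun a b => \tsum_(u, v <- t) F u v a b).
Proof.
move=> /(_ _ _)/cid frF.
exists (flatten [seq sval (frF p.1 p.2) | p <- of_tensor t]) => a b.
rewrite big_flatten big_map; apply: eq_bigr => p _.
by case: (frF p.1 p.2) => s /= ->.
Qed.

(** A basis of the image of [P], lifted to [A]: the quotient of [A] by the
    kernel of [P] has some finite dimension [r], and [e] lifts a basis. *)
Lemma linear_image_spanned n (P : A -> 'rV[k]_n) : linear P ->
  exists r (e : 'I_r -> A),
    forall a, exists c : 'I_r -> k, P a = \sum_i c i *: P (e i).
Proof.
move=> lP.
have [r [p [psurj pP]]] := @finite_codimension_ker k A n (linear_pack lP)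
  [set a | P a = 0]%classic (fun a => conj id id).
have [e eP] : exists e : 'I_r -> A, forall i, p (e i) = delta_mx 0 i.
  by exists (fun i => sval (cid (psurj (delta_mx 0 i)))) => i; case: cid.
exists r, e => a; exists (fun i => p a 0 i).
have /pP/= : p (a - \sum_i p a 0 i *: e i) = 0.
  rewrite linearB linear_sum /= [X in X - _]row_sum_delta.
  apply/eqP; rewrite subr_eq0; apply/eqP/eq_bigr => i _.
  by rewrite linearZ /= eP.
rewrite -[P _]/(linear_pack lP _) linearB linear_sum => /eqP.
rewrite subr_eq0 => /eqP /= ->.
by apply: eq_bigr => i _; exact: (GRing.scalable_linear lP).
Qed.

(** The ideal is the largest one on which [f] vanishes, [{x | f (A x A) = 0}].
    Writing [f (a b) = P a . Q b] with [P] and [Q] valued in a space of finite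
    dimension, it is enough to test [f (a x b) = 0] for [a] in a finite set
    that lifts a basis of the image of [P] and [b] in one for [Q]: finitely
    many linear conditions on [x]. *)
Lemma finite_rank_dual (f : A -> k^o) :
  linear f -> finite_rank (fun a b => f (a * b)) ->
  f \in finite_dual_pred (A := A).
Proof.
move=> lf [s fE]; apply/asboolP; split=> //.
pose n := size s.
pose P (a : A) : 'rV[k]_n := \row_i (tnth (in_tuple s) i).1 a.
pose Q (b : A) : 'rV[k]_n := \row_i (tnth (in_tuple s) i).2 b.
have lP : linear P by move=> c x y; apply/rowP => i; rewrite !mxE linearP.
have lQ : linear Q by move=> c x y; apply/rowP => i; rewrite !mxE linearP.
have fPQ a b : f (a * b) = \sum_i P a 0 i * Q b 0 i.
  rewrite fE (big_tnth _ _ s); apply: eq_bigr => i _.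
  by rewrite !mxE.
have [r [e eP]] := linear_image_spanned lP.
have [r' [d dQ]] := linear_image_spanned lQ.
have f0l y : (forall i, f (e i * y) = 0) -> forall a, f (a * y) = 0.
  move=> ey a; have [c Pa] := eP a; rewrite fPQ Pa.
  under eq_bigr => i _ do rewrite summxE mulr_suml.
  rewrite exchange_big big1 //= => j _; rewrite -[RHS](mulr0 (c j)).
  rewrite -[in RHS](ey j) fPQ mulr_sumr; apply: eq_bigr => i _.
  by rewrite mxE mulrA.
have f0r y : (forall i, f (y * d i) = 0) -> forall b, f (y * b) = 0.
  move=> dy b; have [c Qb] := dQ b; rewrite fPQ Qb.
  under eq_bigr => i _ do rewrite summxE mulr_sumr.
  rewrite exchange_big big1 //= => j _; rewrite -[RHS](mulr0 (c j)).
  rewrite -[in RHS](dy j) fPQ mulr_sumr; apply: eq_bigr => i _.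
  by rewrite [X in _ * X = _]mxE mulrCA.
pose R (x : A) : 'rV[k]_(r * r') := mxvec (\matrix_(i, j) f (e i * x * d j)).
have lR : linear R.
  move=> c x y; rewrite /R -linearP; congr mxvec; apply/matrixP => i j.
  by rewrite !mxE -lf mulrDr mulrDl -scalerAr -scalerAl.
exists [set x | forall a b, f (a * x * b) = 0]%classic; split.
- split=> [a b|x y Ix Iy a b|c x Ix a b|c x Ix a b].
  + by have := lf (-1) 0 0; rewrite mulr0 mul0r !scaleN1r !addNr.
  + rewrite mulrDr mulrDl; have := lf 1 (a * x * b) (a * y * b).
    by rewrite !scale1r => ->; rewrite Ix Iy addr0.
  + by rewrite mulrA Ix.
  + by rewrite mulrA -(mulrA _ c) Ix.
- apply: (@finite_codimension_ker _ _ _ (linear_pack lR)) => x /=; split.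
    rewrite /R => /(canRL mxvecK); rewrite linear0 => Rx a b.
    rewrite -mulrA; apply: (f0l (x * b)) => i; rewrite mulrA; apply: f0r => j.
    by have /matrixP/(_ i j) := Rx; rewrite !mxE.
  move=> Ix; rewrite /R; apply/(canLR vec_mxK); rewrite linear0.
  by apply/matrixP => i j; rewrite !mxE Ix.
- by move=> a /(_ 1 1); rewrite mul1r mulr1.
Qed.

End FiniteRank.

(** * The comultiplication of the finite dual against products *)

Section Pairings.
Variables (k : fieldType) (A : algType k).
Local Notation H := (finite_dual A).
Implicit Types f g h e : H.

Lemma ftens2E f g a b : (f ⊠ g) (a ⊗ b) = f a * g b.
Proof. by apply: ftensE; exact: linearP. Qed.

Lemma linear_ftens2 f g : linear (f ⊠ g).
Proof. by apply: linear_ftens; exact: linearP. Qed.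

Lemma ftens3E f g h a b c : (f ⊠ g ⊠ h) (a ⊗ b ⊗ c) = f a * g b * h c.
Proof.
rewrite ftensE ?ftens2E //; [exact: linear_ftens2|exact: linearP].
Qed.

Lemma linear_ftens3 f g h : linear (f ⊠ g ⊠ h).
Proof. by apply: linear_ftens; [exact: linear_ftens2|exact: linearP]. Qed.

Lemma ftens4E f g h e a b c d :
  (f ⊠ g ⊠ h ⊠ e) (a ⊗ b ⊗ c ⊗ d) = f a * g b * h c * e d.
Proof.
rewrite ftensE ?ftens3E //; [exact: linear_ftens3|exact: linearP].
Qed.

End Pairings.

Notation "\Delta_ ( f1 , f2 <- f ) E" :=
  (tsum (fun f1 f2 : finite_dual _ => E) (finite_dual_comul f))
  (at level 41, E at level 41, f1 name, f2 name, f at level 50,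
   format "'[' \Delta_ ( f1 ,  f2  <-  f ) '/  '  E ']'") : ring_scope.
Notation "\Delta3_ ( f1 , f2 , f3 <- f ) E" :=
  (tsum3 (fun f1 f2 f3 : finite_dual _ => E)
    (comul3 (@finite_dual_comul _ _) f))
  (at level 41, E at level 41, f1 name, f2 name, f3 name, f at level 50,
   format "'[' \Delta3_ ( f1 ,  f2 ,  f3  <-  f ) '/  '  E ']'") : ring_scope.

Section Comul.
Variables (k : fieldType) (A : algType k).
Local Notation H := (finite_dual A).
Implicit Types f g h e : H.

(** The comultiplication of [H ⊗ H] is the transpose of the product of [A ⊗ A]:
    by linearity in [x] and [y] this is checked on pure tensors, where the sums
    over the legs of [f] and [g] separate. *)
Lemma comul_ftens2 f g x y :
  \Delta_(f1, f2 <- f) \Delta_(g1, g2 <- g) (f1 ⊠ g1) x * (f2 ⊠ g2) y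
  = (f ⊠ g) (tmul x y).
Proof.
move: x; apply: tensor_linear_ext; [linear_tac..|move=> a b].
move: y; apply: tensor_linear_ext; [linear_tac..|move=> a' b'].
rewrite tmul_tens ?tensM ftens2E -!finite_dual_comulE; do 2!separate_sums.
by rewrite !ftens2E; ring.
Qed.

Lemma comul_ftens3 f g h x y :
  \Delta_(f1, f2 <- f) \Delta_(g1, g2 <- g) \Delta_(h1, h2 <- h)
    (f1 ⊠ g1 ⊠ h1) x * (f2 ⊠ g2 ⊠ h2) y
  = (f ⊠ g ⊠ h) (tmul x y).
Proof.
move: x; apply: linear_ext3; [linear_tac..|move=> a b c].
move: y; apply: linear_ext3; [linear_tac..|move=> a' b' c'].
rewrite tmul_tens ?tensM ftens3E -!finite_dual_comulE; do 3!separate_sums.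
by rewrite !ftens3E; ring.
Qed.

Lemma comul_ftens4 f g h e x y :
  \Delta_(f1, f2 <- f) \Delta_(g1, g2 <- g) \Delta_(h1, h2 <- h)
    \Delta_(e1, e2 <- e)
    (f1 ⊠ g1 ⊠ h1 ⊠ e1) x * (f2 ⊠ g2 ⊠ h2 ⊠ e2) y
  = (f ⊠ g ⊠ h ⊠ e) (tmul x y).
Proof.
move: x; apply: linear_ext4; [linear_tac..|move=> a b c d].
move: y; apply: linear_ext4; [linear_tac..|move=> a' b' c' d'].
rewrite tmul_tens ?tensM ftens4E -!finite_dual_comulE; do 4!separate_sums.
by rewrite !ftens4E; ring.
Qed.

Lemma tsum_comul3 (W : lmodType k) (F : H -> H -> H -> W) f :
  (forall g h, linear (fun f => F f g h)) ->
  (forall f h, linear (fun g => F f g h)) ->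
  (forall f g, linear (fun h => F f g h)) ->
  tsum3 F (comul3 (@finite_dual_comul k A) f) =
  \Delta_(f1, f2 <- f) \Delta_(f11, f12 <- f1) F f11 f12 f2.
Proof.
move=> lF1 lF2 lF3; rewrite /tsum3 /comul3.
rewrite (tsum_apply (f := tsum _)); last by linear_tac.
by apply: eq_tsum => f1 f2; rewrite tsum_pure // => ?; linear_tac.
Qed.

Lemma comul3E f a b c :
  \Delta3_(f1, f2, f3 <- f) f1 a * (f2 b * f3 c) = f (a * b * c).
Proof.
rewrite tsum_comul3; do ?by move=> ? ?; linear_tac.
rewrite -finite_dual_comulE; apply: eq_tsum => f1 f2.
rewrite -finite_dual_comulE; separate_sums; ring.
Qed.

(** The three factors are convolved on different legs, because [x] is placed in
    the last three of the four factors of [A], and [z] in the first three. *)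
Lemma comul_ftens_pentagon f g h e x y z :
  \Delta_(f1, f2 <- f)
    \Delta3_(g1, g2, g3 <- g) \Delta3_(h1, h2, h3 <- h) \Delta_(e1, e2 <- e)
      (g1 ⊠ h1 ⊠ e1) x * (f1 ⊠ g2 ⊠ h2 ⊠ e2) y * (f2 ⊠ g3 ⊠ h3) z
  = (f ⊠ g ⊠ h ⊠ e) (tmul (tmul (one_tensor x) y) (z ⊗ 1)).
Proof.
have l1 := @linear_one_tensor k A.
move: x; apply: linear_ext3; [linear_tac..|move=> b1 c1 d1].
move: y; apply: linear_ext4; [linear_tac..|move=> a2 b2 c2 d2].
move: z; apply: linear_ext3; [linear_tac..|move=> a3 b3 c3].
rewrite one_tensorE !tmul_tens ?tensM ftens4E mul1r mulr1.
rewrite -!comul3E -!finite_dual_comulE.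
do 4!separate_sums.
by rewrite !ftens3E !ftens4E; ring.
Qed.

End Comul.

Lemma tcomul_pure (k : fieldType) (C D : lmodType k)
    (DC : C -> C \otimes C) (DD : D -> D \otimes D) c d :
  linear DC -> linear DD ->
  tcomul DC DD (c ⊗ d) = \tsum_(c1, c2 <- DC c) \tsum_(d1, d2 <- DD d)
    (c1 ⊗ d1) ⊗ (c2 ⊗ d2).
Proof. by move=> lC lD; apply: tsum_pure => ?; linear_tac. Qed.

Lemma linear_tcomul (k : fieldType) (C D : lmodType k)
    (DC : C -> C \otimes C) (DD : D -> D \otimes D) :
  linear DC -> linear DD -> linear (tcomul DC DD).
Proof. by move=> lC lD; rewrite /tcomul; linear_tac. Qed.

Lemma tsum_tcomul (k : fieldType) (C D W : lmodType k)
    (DC : C -> C \otimes C) (DD : D -> D \otimes D)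
    (F : C \otimes D -> C \otimes D -> W) c d :
  linear DC -> linear DD ->
  (forall y, linear (fun x => F x y)) -> (forall x, linear (F x)) ->
  tsum F (tcomul DC DD (c ⊗ d)) =
  \tsum_(c1, c2 <- DC c) \tsum_(d1, d2 <- DD d) F (c1 ⊗ d1) (c2 ⊗ d2).
Proof.
move=> lC lD lFl lFr; rewrite tcomul_pure //.
have lF : linear (tsum F) by linear_tac.
rewrite (tsum_apply _ _ lF); apply: eq_tsum => c1 c2.
rewrite (tsum_apply _ _ lF); apply: eq_tsum => d1 d2.
by rewrite tsum_pure.
Qed.

(** * Tensors over the finite dual are determined by their values *)

Section Separation.
Variables (k : fieldType) (A : algType k).
Local Notation H := (finite_dual A).

(** In a decomposition [t = \sum u_i ⊗ h_i] with independent [h_i], the values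
    of [t] are those of the combinations [\sum ev x (u_i) *: h_i], so all the
    coefficients vanish. *)
Lemma tensor_separated (U : lmodType k) (X : Type) (ev : X -> U -> k^o) :
  (forall x, linear (ev x)) ->
  (forall u, (forall x, ev x u = 0) -> u = 0) ->
  forall t : U \otimes H,
  (forall x b, \tsum_(u, h <- t) ev x u * (h : H) b = 0) -> t = 0.
Proof.
move=> lev sep t; have [n [u [h [-> hfree]]]] := tensor_indep t => t0.
have u0 i : u i = 0.
  apply: sep => x; apply: (hfree (fun j => ev x (u j))).
  apply: finite_dual_ext => b; rewrite finite_dual_sum.
  have /= := t0 x b.
  have lF : linear (tsum (fun u (h : H) => ev x u * h b : k^o)) by linear_tac.
  rewrite -[tsum _ _]/(linear_pack lF _) linear_sum /= => t0'.
  rewrite [RHS](erefl : _ = 0 :> k^o) -[RHS]t0'.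
  by apply: eq_bigr => j _; rewrite tsum_pure // => ?; linear_tac.
by rewrite big1 // => i _; rewrite u0 -(scale0r 0) tensZl scale0r.
Qed.

Definition eval3 (a b c : A) (t : H \otimes H \otimes H) : k^o :=
  \tsum_(s, h <- t) finite_dual_eval2 s a b * (h : H) c.

Lemma linear_eval2 a b : linear (fun t => @finite_dual_eval2 k A t a b).
Proof. exact: finite_dual_eval2_linear. Qed.

Lemma linear_eval3 a b c : linear (eval3 a b c).
Proof.
by have l2 := linear_eval2 a b; rewrite /eval3; linear_tac.
Qed.

Lemma eval2E (f g : H) a b : finite_dual_eval2 (f ⊗ g) a b = f a * g b.
Proof. by apply: tsum_tens; apply: finite_dual_eval2_bilin. Qed.

Lemma eval3E (f g h : H) a b c : eval3 a b c (f ⊗ g ⊗ h) = f a * g b * h c.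
Proof.
have l2 := linear_eval2 a b.
by rewrite /eval3 tsum_pure ?eval2E // => ?; linear_tac.
Qed.

Lemma eval3_inj s t : (forall a b c, eval3 a b c s = eval3 a b c t) -> s = t.
Proof.
move=> st; apply/eqP; rewrite -subr_eq0; apply/eqP.
apply: (@tensor_separated _ (A * A)%type
          (fun p u => finite_dual_eval2 u p.1 p.2)).
- by move=> p; apply: linear_eval2.
- move=> u u0; apply: finite_dual_eval2_inj => a b; rewrite (u0 (a, b)).
  have := linear_eval2 a b (-1) 0 0.
  by rewrite scaleN1r addNr scaleN1r addNr => ->.
- move=> [a b] c; rewrite -[LHS]/(eval3 a b c _).
  rewrite -[eval3 a b c _]/(linear_pack (linear_eval3 a b c) _) linearB /=.
  by rewrite st subrr.
Qed.

End Separation.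

(** * The transposed structure maps *)

Section DualStructure.
Variables (k : fieldType) (A : algType k).
Variables (Delta : {lrmorphism A -> A \otimes A}) (eps : {lrmorphism A -> k^o}).
Local Notation H := (finite_dual A).
Implicit Types f g h : H.

Lemma dual_mul_finite f g :
  (fun a => (f ⊠ g) (Delta a)) \in finite_dual_pred (A := A).
Proof.
apply: finite_rank_dual; first by linear_tac.
have -> : (fun a b => (f ⊠ g) (Delta (a * b))) = (fun a b =>
    \Delta_(f1, f2 <- f) \Delta_(g1, g2 <- g)
      (f1 ⊠ g1) (Delta a) * (f2 ⊠ g2) (Delta b)).
  by apply/funext => a; apply/funext => b; rewrite comul_ftens2 rmorphM.
apply: finite_rank_tsum => f1 f2; apply: finite_rank_tsum => g1 g2.
by apply: finite_rank_mul; linear_tac.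
Qed.

Definition dual_mul2 f g : H := FiniteDual (dual_mul_finite f g).

Lemma linear_dual_mul2l g : linear (fun f => dual_mul2 f g).
Proof.
move=> c f f'; apply: finite_dual_ext => a.
suff lF : linear (fun f : H => (f ⊠ g) (Delta a)) by exact: lF.
by rewrite /ftens; linear_tac.
Qed.

Lemma linear_dual_mul2r f : linear (dual_mul2 f).
Proof.
move=> c g g'; apply: finite_dual_ext => a.
suff lF : linear (fun g : H => (f ⊠ g) (Delta a)) by exact: lF.
by rewrite /ftens; linear_tac.
Qed.

Definition dual_mul : {linear H \otimes H -> H} :=
  linear_pack
    (tsum_is_linear (bilinear_of linear_dual_mul2l linear_dual_mul2r)).

Lemma dual_mulE f g a : dual_mul (f ⊗ g) a = (f ⊠ g) (Delta a).
Proof.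
rewrite [dual_mul _]tsum_pure //.
  exact: linear_dual_mul2l.
exact: linear_dual_mul2r.
Qed.

Lemma dual_one_finite : (eps : A -> k^o) \in finite_dual_pred (A := A).
Proof.
apply: finite_rank_dual; first exact: linearP.
have -> : (fun a b => eps (a * b)) = (fun a b => eps a * eps b).
  by apply/funext => a; apply/funext => b; rewrite rmorphM.
by apply: finite_rank_mul; exact: linearP.
Qed.

Definition dual_one : H := FiniteDual dual_one_finite.

Lemma linear_dual_unit : linear (fun c : k^o => (c : k) *: dual_one).
Proof. by move=> c d e; rewrite scalerDl scalerA. Qed.

Definition dual_unit : {linear k^o -> H} := linear_pack linear_dual_unit.

Lemma dual_unit1 : dual_unit 1 = dual_one.
Proof. exact: scale1r. Qed.

Definition dual_form (X : A \otimes A \otimes A) (t : H \otimes H \otimes H)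
    : k^o :=
  tsum3 (fun f g h : H => (f ⊠ g ⊠ h) X) t.

Lemma linear_dual_form X : linear (dual_form X).
Proof. by rewrite /dual_form /ftens; linear_tac. Qed.

Definition dual_omega X : {linear H \otimes H \otimes H -> k^o} :=
  linear_pack (linear_dual_form X).

Lemma dual_omegaE X f g h : dual_omega X (f ⊗ g ⊗ h) = (f ⊠ g ⊠ h) X.
Proof. by apply: tsum3_pure => ? ?; rewrite /ftens; linear_tac. Qed.

End DualStructure.

(** * Coalgebra axioms and convolution *)

Section DualCoalgebra.
Variables (k : fieldType) (A : algType k).
Local Notation H := (finite_dual A).
Implicit Types f g h : H.

Lemma finite_dual_coalgebra :
  coalgebra (@finite_dual_comul k A) (@finite_dual_counit k A).
Proof.
split=> [f|f|f].
- apply: eval3_inj => a b c; have lE := @linear_eval3 k A a b c.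
  rewrite !(tsum_apply _ _ lE).
  transitivity (f (a * b * c)).
    rewrite -finite_dual_comulE; apply: eq_tsum => f1 f2.
    rewrite /eval3 tsum_pure; last by move=> ?; linear_tac.
      by rewrite [finite_dual_eval2 _ _ _]finite_dual_comulE.
    by move=> h; have := @linear_eval2 k A a b => l2; linear_tac.
  rewrite -mulrA -finite_dual_comulE; apply: eq_tsum => f1 f2.
  rewrite (tsum_apply _ _ lE) -finite_dual_comulE tsum_mulr.
  by apply: eq_tsum => f21 f22; rewrite eval3E mulrA.
- apply: finite_dual_ext => a.
  rewrite (tsum_apply (f := fun h : H => h a : k^o)); last by linear_tac.
  by rewrite -[in RHS](mul1r a) -finite_dual_comulE.
- apply: finite_dual_ext => a.
  rewrite (tsum_apply (f := fun h : H => h a : k^o)); last by linear_tac.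
  rewrite -[in RHS](mulr1 a) -finite_dual_comulE; apply: eq_tsum => f1 f2.
  by rewrite finite_dualZ [LHS]mulrC.
Qed.

End DualCoalgebra.

Section DualQuasi.
Variables (k : fieldType) (A : algType k).
Variables (Delta : {lrmorphism A -> A \otimes A}) (eps : {lrmorphism A -> k^o}).
Local Notation H := (finite_dual A).
Implicit Types f g h : H.
Local Notation comul := (@finite_dual_comul k A).
Local Notation counit := (@finite_dual_counit k A).
Local Notation mul := (dual_mul Delta).

Lemma linear_comul : linear comul.
Proof. exact: linearP. Qed.

Lemma dual_mul_morphism : coalgebra_morphism
    (tcomul comul comul) (tcounit counit counit) comul counit mul.
Proof.
split; apply: tensor_linear_ext.
- by linear_tac.
- by rewrite /tmap /tcomul; linear_tac.
- move=> f g; apply: finite_dual_eval2_inj => a b.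
  have lE := @linear_eval2 k A a b.
  rewrite [LHS]finite_dual_comulE dual_mulE rmorphM.
  rewrite -[_ * _]/(tmul _ _) -comul_ftens2 /tmap tsum_tcomul; first last.
  + by move=> ?; linear_tac.
  + by move=> ?; linear_tac.
  + exact: linearP.
  + exact: linearP.
  rewrite (tsum_apply _ _ lE); apply: eq_tsum => f1 f2.
  rewrite (tsum_apply _ _ lE); apply: eq_tsum => g1 g2.
  by rewrite eval2E !dual_mulE.
- by linear_tac.
- by rewrite /tcounit; linear_tac.
- move=> f g; rewrite /tcounit tsum_pure; do ?by move=> ?; linear_tac.
  by rewrite /finite_dual_counit dual_mulE rmorph1 ftens2E.
Qed.

Lemma dual_unit_morphism : coalgebra_morphism
    (@kcomul k) (@kcounit k) comul counit (dual_unit eps).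
Proof.
split=> c; last first.
  by rewrite /finite_dual_counit finite_dualZ /= rmorph1 /kcounit [LHS]mulr1.
apply: finite_dual_eval2_inj => a b; rewrite [LHS]finite_dual_comulE.
rewrite /tmap /kcomul tsum_pure; do ?by move=> ?; linear_tac.
by rewrite eval2E dual_unit1 !finite_dualZ /= rmorphM -scalerAl.
Qed.

(** Evaluation at [X] turns products into convolution products; this is what
    makes the evaluation at the inverse of [Φ] an inverse of [ω]. *)
Lemma dual_omega_convolution X Y t :
  convolution (tcomul (tcomul comul comul) comul)
    (dual_omega X) (dual_omega Y) t
  = dual_omega (tmul X Y) t.
Proof.
have lT : linear (tcomul comul comul) by apply: linear_tcomul; exact: linearP.
move: t; apply: linear_ext3.
- have lT3 := linear_tcomul lT linear_comul.
  by rewrite /convolution; linear_tac.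
- by linear_tac.
move=> f g h; rewrite /convolution tsum_tcomul //; do ?by move=> ?; linear_tac.
rewrite dual_omegaE -comul_ftens3 [LHS]tsum_tcomul; first last.
- move=> ?; linear_tac.
- move=> ?; linear_tac.
- exact: linearP.
- exact: linearP.
do 3!apply: eq_tsum => ? ?.
by rewrite !dual_omegaE.
Qed.

Lemma dual_omega1 t :
  dual_omega (1 ⊗ 1 ⊗ 1) t = tcounit (tcounit counit counit) counit t.
Proof.
have lT : linear (tcounit counit counit) by rewrite /tcounit; linear_tac.
move: t; apply: linear_ext3; first by linear_tac.
  by rewrite {1}/tcounit; linear_tac.
move=> f g h; rewrite dual_omegaE ftens3E.
rewrite {1}/tcounit tsum_pure; do ?by move=> ?; linear_tac.
by rewrite /tcounit tsum_pure // => ?; linear_tac.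
Qed.

End DualQuasi.

(** * Products of functionals on one leg *)

Section Products.
Variables (k : fieldType) (A : algType k).
Variables (Delta : {lrmorphism A -> A \otimes A}).
Local Notation H := (finite_dual A).
Implicit Types f g h e : H.
Local Notation mul := (dual_mul Delta).

(** The product of functionals is the transpose of [Delta], so that a product in
    one factor moves to [Delta] on the corresponding leg of [X]. *)
Lemma ftens_mul_1 f g h e X :
  (mul (f ⊗ g) ⊠ h ⊠ e) X = (f ⊠ g ⊠ h ⊠ e) (Delta_1 Delta X).
Proof.
have lD := @linear_Delta_1 k A Delta.
move: X; apply: linear_ext3; [linear_tac..|move=> x y z].
rewrite ftens3E dual_mulE Delta_1E.
move: (Delta x); apply: tensor_linear_ext; [linear_tac..|move=> x1 x2].
by rewrite ftens4E ftens2E.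
Qed.

Lemma ftens_mul_2 f g h e X :
  (f ⊠ mul (g ⊗ h) ⊠ e) X = (f ⊠ g ⊠ h ⊠ e) (Delta_2 Delta X).
Proof.
have lD := @linear_Delta_2 k A Delta.
move: X; apply: linear_ext3; [linear_tac..|move=> x y z].
have lf : linear (f ⊠ g ⊠ h ⊠ e) by linear_tac.
rewrite ftens3E dual_mulE Delta_2E (tsum_apply _ _ lf).
rewrite /ftens tsum_mulr tsum_mull; apply: eq_tsum => y1 y2.
by rewrite -!/(ftens _ _ _) ftens4E; ring.
Qed.

Lemma ftens_mul_3 f g h e X :
  (f ⊠ g ⊠ mul (h ⊗ e)) X = (f ⊠ g ⊠ h ⊠ e) (Delta_3 Delta X).
Proof.
have lD := @linear_Delta_3 k A Delta.
move: X; apply: linear_ext3; [linear_tac..|move=> x y z].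
have lf : linear (f ⊠ g ⊠ h ⊠ e) by linear_tac.
rewrite ftens3E dual_mulE Delta_3E (tsum_apply _ _ lf).
rewrite {1}/ftens tsum_mulr; apply: eq_tsum => z1 z2.
by rewrite ftens4E; ring.
Qed.

Lemma dual_mul_left f g h a :
  mul (mul (f ⊗ g) ⊗ h) a = (f ⊠ g ⊠ h) (coassoc_l Delta a).
Proof.
have lf : linear (f ⊠ g ⊠ h) by linear_tac.
rewrite dual_mulE /coassoc_l (tsum_apply _ _ lf) {1}/ftens.
apply: eq_tsum => a1 a2; rewrite dual_mulE ftensE //; linear_tac.
Qed.

Lemma dual_mul_right f g h a :
  mul (f ⊗ mul (g ⊗ h)) a = (f ⊠ g ⊠ h) (coassoc_r Delta a).
Proof.
have lf : linear (f ⊠ g ⊠ h) by linear_tac.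
rewrite dual_mulE /coassoc_r (tsum_apply _ _ lf) {1}/ftens.
apply: eq_tsum => a1 a2; rewrite dual_mulE (tsum_apply _ _ lf).
rewrite /ftens tsum_mulr; apply: eq_tsum => a21 a22.
by rewrite -!/(ftens _ _ _) ftens3E mulrA.
Qed.

End Products.

(** * The finite dual as a coquasi-bialgebra with preantipode *)

Section Dual.
Variables (k : fieldType) (A : algType k).
Variables (Delta : {lrmorphism A -> A \otimes A}) (eps : {lrmorphism A -> k^o}).
Variables (Phi Psi : A \otimes A \otimes A) (S : {linear A -> A}).
Local Notation H := (finite_dual A).
Implicit Types f g h : H.
Local Notation comul := (@finite_dual_comul k A).
Local Notation counit := (@finite_dual_counit k A).
Local Notation mul := (dual_mul Delta).
Hypothesis qb : quasi_bialgebra Delta eps Phi.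
Hypothesis PsiK : tmul Phi Psi = 1 ⊗ 1 ⊗ 1.
Hypothesis PhiK : tmul Psi Phi = 1 ⊗ 1 ⊗ 1.

Lemma dual_coquasi_bialgebra :
  coquasi_bialgebra comul counit mul (dual_unit eps) (dual_omega Phi).
Proof.
split.
- exact: finite_dual_coalgebra.
- exact: dual_mul_morphism.
- exact: dual_unit_morphism.
- exists (dual_omega Psi); split=> t; rewrite dual_omega_convolution.
    by rewrite PsiK dual_omega1.
  by rewrite PhiK dual_omega1.
- move=> a b c d.
  (* Both sides are values at the two sides of the pentagon. *)
  transitivity ((a ⊠ b ⊠ c ⊠ d) (tmul (Delta_3 Delta Phi) (Delta_1 Delta Phi))).
    rewrite -comul_ftens4; do 4!apply: eq_tsum => ? ?.
    by rewrite !dual_omegaE ftens_mul_3 ftens_mul_1.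
  transitivity ((a ⊠ b ⊠ c ⊠ d)
      (tmul (tmul (one_tensor Phi) (Delta_2 Delta Phi)) (Phi ⊗ 1))).
    by congr (ftens _ _); apply/esym/(qb_cocycle qb).
  rewrite -comul_ftens_pentagon; apply: eq_tsum => ? ?.
  do 2!apply: eq_tsum3 => ? ? ?; apply: eq_tsum => ? ?.
  by rewrite !dual_omegaE ftens_mul_2.
- move=> f g; rewrite dual_unit1 dual_omegaE.
  transitivity ((f ⊠ g) (counit_2 eps Phi)).
    have lc := @linear_counit_2 k A eps.
    have lf : linear (f ⊠ g) by linear_tac.
    move: Phi; apply: linear_ext3; [linear_tac..|move=> x y z].
    rewrite ftens3E counit_2E (GRing.scalable_linear lf) ftens2E.
    by rewrite mulrAC mulrC.
  have -> : counit_2 eps Phi = 1 ⊗ 1.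
    rewrite -[RHS](qb_Phi_normal qb); apply: eq_tsum3 => x y z.
    by rewrite tensZr.
  exact: ftens2E.
- move=> f; apply: finite_dual_ext => a; rewrite dual_unit1 dual_mulE.
  rewrite -[in RHS](qb_counitl qb a) (tsum_apply (f := f)); last by linear_tac.
  by apply: eq_tsum => a1 a2; rewrite linearZ.
- move=> f; apply: finite_dual_ext => a; rewrite dual_unit1 dual_mulE.
  rewrite -[in RHS](qb_counitr qb a) (tsum_apply (f := f)); last by linear_tac.
  by apply: eq_tsum => a1 a2; rewrite linearZ mulrC.
- move=> f g h; apply: finite_dual_ext => a.
  (* At [a], both sides are values at the two sides of the coassociativity
     of [Delta] up to [Phi], applied to [a]. *)
  have la : linear (fun h : H => h a : k^o) by linear_tac.
  rewrite (tsum_apply _ _ la) [RHS](tsum_apply _ _ la).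
  transitivity ((f ⊠ g ⊠ h) (tmul (coassoc_r Delta a) Phi)).
    rewrite -comul_ftens3; apply: eq_tsum => f1 f2.
    rewrite (tsum_apply _ _ la); apply: eq_tsum => g1 g2.
    rewrite (tsum_apply _ _ la); apply: eq_tsum => h1 h2.
    by rewrite finite_dualZ dual_omegaE dual_mul_right [LHS]mulrC.
  rewrite -[tmul _ _](qb_coassoc qb) -[_ * _]/(tmul _ _).
  rewrite -comul_ftens3; apply: eq_tsum => f1 f2.
  rewrite (tsum_apply _ _ la); apply: eq_tsum => g1 g2.
  rewrite (tsum_apply _ _ la); apply: eq_tsum => h1 h2.
  by rewrite finite_dualZ dual_omegaE dual_mul_left.
Qed.

Hypothesis pre : qb_preantipode Delta eps Phi S.

(** Splitting [f] along the factors of [S (a b) = \sum S (x b) y S (a z)]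
    separates [a] from [b]. *)
Lemma dual_preantipode_finite f :
  (fun a => f (S a)) \in finite_dual_pred (A := A).
Proof.
apply: finite_rank_dual; first by linear_tac.
have -> : (fun a b => f (S (a * b))) = (fun a b => tsum3 (fun x y z =>
    \Delta_(f1, f2 <- f) \Delta_(f11, f12 <- f1)
      f2 (S (a * z)) * (f11 (S (x * b)) * f12 y)) Psi).
  apply/funext => a; apply/funext => b.
  rewrite (@preantipodeM k A Delta eps (qb_counitl qb) (qb_counitr qb)
             Phi Psi).
  - rewrite tsum3_apply; last by linear_tac.
    apply: eq_tsum3 => x y z; rewrite -finite_dual_comulE.
    apply: eq_tsum => f1 f2; rewrite -finite_dual_comulE tsum_mull.
    by apply: eq_tsum => f11 f12; rewrite mulrC.
  - exact: PhiK.
  - exact: PsiK.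
  - exact: qb_cocycle qb.
  - rewrite -[RHS](qb_Phi_normal qb); apply: eq_tsum3 => x y z.
    by rewrite tensZr.
  - exact: qb_preantipode_l pre.
  - exact: qb_preantipode_r pre.
  - exact: qb_preantipode_Phi pre.
  - move=> c.
    have E : tmul Phi (coassoc_l Delta c) = tmul (coassoc_r Delta c) Phi.
      exact: qb_coassoc qb c.
    have := congr1 (fun X => tmul (tmul Psi X) Psi) E.
    by rewrite tmulA PhiK tmul1t => ->; rewrite -!tmulA PsiK tmult1.
rewrite /tsum3; do 2!apply: finite_rank_tsum => ? ?.
do 2!apply: finite_rank_tsum => ? ?.
apply: finite_rank_mul; linear_tac.
Qed.

Definition dual_preantipode1 f : H := FiniteDual (dual_preantipode_finite f).

Lemma linear_dual_preantipode1 : linear dual_preantipode1.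
Proof. by move=> c f g; apply: finite_dual_ext. Qed.

Definition dual_preantipode : {linear H -> H} :=
  linear_pack linear_dual_preantipode1.

Lemma dual_preantipode_cqb : cqb_preantipode comul counit mul (dual_unit eps)
  (dual_omega Phi) dual_preantipode.
Proof.
split=> h.
- apply: finite_dual_eval2_inj => a b; have lE := @linear_eval2 k A a b.
  rewrite eval2E dual_unit1 (tsum_apply _ _ lE).
  transitivity (\Delta_(h1, h2 <- h) \Delta_(t1, t2 <- dual_preantipode h1)
      (t1 ⊠ h2) (Delta a) * t2 b).
    apply: eq_tsum => h1 h2; rewrite (tsum_apply _ _ lE).
    by apply: eq_tsum => t1 t2; rewrite eval2E dual_mulE.
  transitivity (h (\tsum_(a1, a2 <- Delta a) S (a1 * b) * a2)); last first.
    by rewrite (qb_preantipode_r pre) linearZ.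
  (* The equation holds with any tensor in place of [Delta a]. *)
  move: (Delta a); apply: tensor_linear_ext; [linear_tac..|move=> a1 a2].
  rewrite tsum_pure; do ?by move=> ?; linear_tac.
  rewrite -finite_dual_comulE; apply: eq_tsum => h1 h2.
  rewrite -[h1 (S _)]/(dual_preantipode h1 _) -finite_dual_comulE tsum_mull.
  by apply: eq_tsum => t1 t2; rewrite ftens2E; ring.
- apply: finite_dual_eval2_inj => a b; have lE := @linear_eval2 k A a b.
  rewrite eval2E dual_unit1 (tsum_apply _ _ lE).
  transitivity (\Delta_(h1, h2 <- h) \Delta_(t1, t2 <- dual_preantipode h2)
      t1 a * (h1 ⊠ t2) (Delta b)).
    apply: eq_tsum => h1 h2; rewrite (tsum_apply _ _ lE).
    by apply: eq_tsum => t1 t2; rewrite eval2E dual_mulE.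
  transitivity (h (\tsum_(b1, b2 <- Delta b) b1 * S (a * b2))); last first.
    by rewrite (qb_preantipode_l pre) linearZ [LHS]mulrC.
  move: (Delta b); apply: tensor_linear_ext; [linear_tac..|move=> b1 b2].
  rewrite tsum_pure; do ?by move=> ?; linear_tac.
  rewrite -finite_dual_comulE; apply: eq_tsum => h1 h2.
  rewrite -[h2 (S _)]/(dual_preantipode h2 _) -finite_dual_comulE tsum_mulr.
  by apply: eq_tsum => t1 t2; rewrite ftens2E; ring.
- transitivity (h (\tsum_(x, y, z <- Phi) x * S y * z)); last first.
    by rewrite (qb_preantipode_Phi pre).
  transitivity (\Delta3_(h1, h2, h3 <- h) (h1 ⊠ dual_preantipode h2 ⊠ h3) Phi).
    by apply: eq_tsum3 => h1 h2 h3; rewrite dual_omegaE.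
  move: Phi; apply: linear_ext3; [linear_tac..|move=> x y z].
  rewrite tsum3_pure; do ?by move=> ? ?; linear_tac.
  rewrite -comul3E; apply: eq_tsum3 => h1 h2 h3.
  by rewrite ftens3E mulrA.
Qed.

End Dual.

Theorem proposition3p3 (k : fieldType) (A : algType k)
    (Delta : {lrmorphism A -> A \otimes A}) (eps : {lrmorphism A -> k^o})
    (Phi : A \otimes A \otimes A) (S : {linear A -> A}) :
  quasi_bialgebra Delta eps Phi -> qb_preantipode Delta eps Phi S ->
  let H := finite_dual A in
  exists (mul : {linear H \otimes H -> H}) (u : {linear k^o -> H})
         (omega : {linear H \otimes H \otimes H -> k^o}) (T : {linear H -> H}),
    coquasi_bialgebra (@finite_dual_comul k A) (@finite_dual_counit k A)
      mul u omega /\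
    cqb_preantipode (@finite_dual_comul k A) (@finite_dual_counit k A)
      mul u omega T.
Proof.
move=> qb pre H; have [Psi [PsiK PhiK]] := qb_Phi_invertible qb.
exists (dual_mul Delta), (dual_unit eps), (dual_omega Phi).
exists (dual_preantipode qb PsiK PhiK pre); split.
  exact: dual_coquasi_bialgebra PsiK PhiK.
exact: dual_preantipode_cqb.
Qed.
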